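(* Let $m,\tilde m\in\mathbb{N}$ with $m\le\tilde m$ and $m+\tilde m\in2\mathbb{N}$, and let $p\in\mathbb{N}_0$. Let $\{\tilde A_k\}_{k\in\mathbb{Z}}$ be the finitely supported sequence of $(p+1)\times(p+1)$ dual refinement matrices with symbol $\tilde{\mathcal{A}}(z)=\frac12\sum_{k\in\mathbb{Z}}\tilde A_kz^k$ determined by $\overline{\tilde{\mathcal{A}}(z)}^T=b(-z)T(z)^{-1}$ for $|z|=1$. Let $v$ be a right eigenvector of $2^{-p}\tilde{\mathcal{A}}(1)$ corresponding to the eigenvalue $1$. Let $D^p$ denote the $p$-th distributional derivative operator. Then the matrix refinement equation $$\begin{pmatrix}\tilde\varphi_0\\ \vdots\\ \tilde\varphi_p\end{pmatrix}=\sum_{k\in\mathbb{Z}}\tilde A_k\begin{pmatrix}\tilde\varphi_0(2\cdot-k)\\ \vdots\\ \tilde\varphi_p(2\cdot-k)\end{pmatrix}$$ has a compactly supported distributional solution vector $\tilde\Phi=(\tilde\varphi_0,\dots,\tilde\varphi_p)^T\in(\mathcal{S}'(\mathbb{R}))^{p+1}$ which is given by $$\begin{pmatrix}\tilde\varphi_0\\ \vdots\\ \tilde\varphi_p\end{pmatrix}=D^p\mathcal{F}^{-1}\Big[\prod_{j=1}^\infty2^{-p}\tilde{\mathcal{A}}(e^{-i2^{-j}\xi})\,v\Big].$$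
   Context: $\mathbb{N}=\{1,2,\dots\}$, $\mathbb{N}_0=\mathbb{N}\cup\{0\}$. Fourier transform: $(\mathcal{F}f)(\xi)=\frac1{\sqrt{2\pi}}\int_{\mathbb{R}}f(x)e^{-ix\xi}dx$ for $f\in L_1(\mathbb{R})$, extended to the tempered distributions $\mathcal{S}'(\mathbb{R})$, with inverse $\mathcal{F}^{-1}$; $D^p$ and $\mathcal{F}^{-1}$ act componentwise on vectors. The infinite matrix product is ordered with increasing $j$ from left to right, i.e. $\prod_{j=1}^\infty M_jv=\lim_{n\to\infty}M_1M_2\cdots M_nv$ (pointwise in $\xi$). Coefficients $b_k$: put $K=(m+\tilde m)/2$ and for $|z|=1$ let $\tilde a(z)=z^{-\lfloor\tilde m/2\rfloor}\big(\tfrac{1+z}{2}\big)^{\tilde m}\sum_{n=0}^{K-1}\binom{K-1+n}{n}\big(\tfrac{2-z-z^{-1}}{4}\big)^n$ (symbol of the Cohen--Daubechies--Feauveau dual generator). The finitely supported real sequence $(b_k)_{k\in\mathbb{Z}}$ is determined by $b(z):=\frac12\sum_kb_kz^k=-z\,\overline{\tilde a(-z)}$ for $|z|=1$. Refinement matrices of the quark vector $(\varphi_0,\dots,\varphi_p)^T$, $\varphi_q(x)=(x/\lceil m/2\rceil)^qN_m(x+\lfloor m/2\rfloor)$ with $N_m$ the cardinal B-spline of order $m$ ($N_1=\chi_{[0,1)}$, $N_m=\int_0^1N_{m-1}(\cdot-t)dt$): $(A_k)_{q,l}=2^{1-q}\lceil m/2\rceil^{l-q}a_k\binom{q-1}{l-1}k^{q-l}$,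 $q,l\in\{1,\dots,p+1\}$, where $a_k=2^{1-m}\binom{m}{k+\lfloor m/2\rfloor}$ for $-\lfloor m/2\rfloor\le k\le\lceil m/2\rceil$ and $a_k=0$ otherwise (entries with $l>q$ are $0$, $0^0=1$). Put $\mathcal{A}(z)=\frac12\sum_kA_kz^k$ and $T(z)=\mathcal{A}(z)b(-z)-b(z)\mathcal{A}(-z)$, which is invertible for $|z|=1$ with inverse consisting of Laurent polynomials; hence $\tilde{\mathcal{A}}$ consists of Laurent polynomials in $z$ and the finitely supported sequence $\{\tilde A_k\}$ is well defined. *)

(* Defs.v *)
From HB Require Import structures.
From mathcomp Require Import all_boot all_order all_algebra.
From mathcomp Require Import all_classical all_reals all_analysis.
From mathcomp Require Import complex.

Set Implicit Arguments.
Unset Strict Implicit.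
Unset Printing Implicit Defensive.

Import Order.TTheory GRing.Theory Num.Theory.
Import numFieldNormedType.Exports.

Local Open Scope classical_set_scope.
Local Open Scope ring_scope.
Local Open Scope complex_scope.

(* R[i] carries no topology, measure or differential structure in the
   libraries; limits, derivatives (in a real variable) and integrals of
   complex-valued functions are taken on real and imaginary parts. *)
Section ComplexValued.
Context {R : realType}.
Local Notation C := R[i].
Local Notation mu := (@lebesgue_measure R).
Local Notation Re := (@complex.Re R).
Local Notation Im := (@complex.Im R).

Definition expi (t : R) : C := cos t +i* sin t.

Definition ccvg (u : nat -> C) (l : C) : Prop :=
  (Re (u n) @[n --> \oo] --> Re l) /\ (Im (u n) @[n --> \oo] --> Im l).

Definition cderiven (n : nat) (f : R -> C) : R -> C :=
  fun x => derive1n n (Re \o f) x +i* derive1n n (Im \o f) x.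

Definition csmooth (f : R -> C) : Prop := forall n x,
  derivable (derive1n n (Re \o f)) x 1 /\ derivable (derive1n n (Im \o f)) x 1.

Definition cintegrable (f : R -> C) : Prop :=
  mu.-integrable setT (EFin \o (Re \o f)) /\
  mu.-integrable setT (EFin \o (Im \o f)).

Definition cintegral (f : R -> C) : C :=
  (\int[mu]_x Re (f x)) +i* (\int[mu]_x Im (f x)).

End ComplexValued.

Section TemperedDistributions.
Context {R : realType}.
Local Notation C := R[i].
Local Notation normc := (@ComplexField.Normc.normc R).

Definition schwartz (f : R -> C) : Prop :=
  csmooth f /\
  forall k n : nat, exists M : R, forall x,
    `|x| ^+ k * normc (cderiven n f x) <= M.

Definition seminorm (k n : nat) (f : R -> C) : R :=
  sup [set `|x| ^+ k * normc (cderiven n f x) | x in [set: R]].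

(* A distribution is represented by a functional on all of R -> C of which only
   the restriction to Schwartz functions is meaningful: the predicates below
   never look at other arguments, and equality of tempered distributions means
   equality on Schwartz functions. The pairing is bilinear (no conjugation). *)
Definition tdistribution := (R -> C) -> C.

Definition tempered (u : tdistribution) : Prop :=
  (forall (c : C) (f g : R -> C), schwartz f -> schwartz g ->
     u (fun x => c * f x + g x) = c * u f + u g) /\
  (exists (M : R) (N : nat), forall f, schwartz f ->
     normc (u f) <= M * \sum_(k < N.+1) \sum_(n < N.+1) seminorm k n f).

Definition regular_distribution (g : R -> C) : tdistribution :=
  fun f => cintegral (fun x => g x * f x).

Definition tempered_function (g : R -> C) : Prop :=
  (forall f, schwartz f -> cintegrable (fun x => g x * f x)) /\
  tempered (regular_distribution g).

Definition dderiven (n : nat) (u : tdistribution) : tdistribution :=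
  fun f => (-1) ^+ n * u (cderiven n f).

Definition inverse_fourier (f : R -> C) : R -> C := fun x =>
  (Num.sqrt (2 * pi))^-1%:C * cintegral (fun xi => f xi * expi (x * xi)).

Definition dinverse_fourier (u : tdistribution) : tdistribution :=
  fun f => u (inverse_fourier f).

(* the distribution u(2 x - k), by the substitution y = 2 x - k *)
Definition refine_shift (k : int) (u : tdistribution) : tdistribution :=
  fun f => 2^-1 * u (fun y => f ((y + k%:~R) / 2)).

Definition fsupport (f : R -> C) : set R := closure [set x | f x != 0].

Definition dsupport (u : tdistribution) : set R :=
  [set x | forall U : set R, open U -> U x ->
    exists f, [/\ schwartz f, compact (fsupport f), fsupport f `<=` U &
                  u f != 0]].

Definition matrix_refinable (n : nat) (A : int -> 'M[C]_n)
    (Phi : 'I_n -> tdistribution) : Prop :=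
  forall (q : 'I_n) (f : R -> C), schwartz f ->
    Phi q f = \sum_(k \in [set: int])
                \sum_(l < n) A k q l * refine_shift k (Phi l) f.

End TemperedDistributions.

Section Symbols.
Context {R : realType}.
Local Notation C := R[i].

(* The sums over all integers below are sums over the finite support. *)
Definition symbol (b : int -> R) (z : C) : C :=
  2^-1 * \sum_(k \in [set: int]) (b k)%:C * z ^ k.

Definition mx_symbol (n : nat) (A : int -> 'M[C]_n) (z : C) : 'M[C]_n :=
  2^-1 *: \sum_(k \in [set: int]) z ^ k *: A k.

Definition cdf_dual_symbol (m mt : nat) (z : C) : C :=
  let K := (m + mt)./2 in
  z ^- mt./2 * ((1 + z) / 2) ^+ mt *
  \sum_(n < K) 'C(K - 1 + n, n)%:R * ((2 - z - z^-1) / 4) ^+ n.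

Definition cdf_wavelet_coef (m mt : nat) (b : int -> R) : Prop :=
  finite_set [set k | b k != 0] /\
  forall z : C, `|z| = 1 ->
    symbol b z = - z * (cdf_dual_symbol m mt (- z))^*.

Definition spline_mask (m : nat) (k : int) : C :=
  if (- (m./2)%:Z <= k) && (k <= (uphalf m)%:Z) then
    2 ^ (1 - m%:Z) * 'C(m, absz (k + (m./2)%:Z))%:R
  else 0.

(* Indices are shifted to start at 0, i.e. q = i + 1 and l = j + 1; the entries
   with j > i vanish because of the binomial coefficient, which makes the
   truncated natural exponent i - j harmless. *)
Definition quark_mask (m p : nat) (k : int) : 'M[C]_p.+1 :=
  \matrix_(i, j) (2 ^- i * (uphalf m)%:R ^ (j%:Z - i%:Z) * spline_mask m k
                  * 'C(i, j)%:R * k%:~R ^+ (i - j)).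

Definition quark_T (m p : nat) (b : int -> R) (z : C) : 'M[C]_p.+1 :=
  symbol b (- z) *: mx_symbol (quark_mask m p) z
  - symbol b z *: mx_symbol (quark_mask m p) (- z).

Definition dual_refinement_matrices (m p : nat) (b : int -> R)
    (At : int -> 'M[C]_p.+1) : Prop :=
  finite_set [set k | At k != 0] /\
  forall z : C, `|z| = 1 ->
    (map_mx (@conjc R) (mx_symbol At z))^T
    = symbol b (- z) *: invmx (quark_T m p b z).

(* \prod on the matrix ring multiplies from left to right. *)
Definition dual_partial_product (p : nat) (At : int -> 'M[C]_p.+1)
    (v : 'cV[C]_p.+1) (n : nat) (xi : R) : 'cV[C]_p.+1 :=
  (\prod_(1 <= j < n.+1)
     (2 ^- p *: mx_symbol At (expi (- (2 ^- j * xi))))) *m v.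

End Symbols.

(* Main.v *)
Require Import Defs.
From HB Require Import structures.
From mathcomp Require Import all_boot all_order all_algebra.
From mathcomp Require Import all_classical all_reals all_analysis.
From mathcomp Require Import complex.
From mathcomp Require Import measurable_realfun zify ring lra.
Import Order.TTheory GRing.Theory Num.Theory.
Import numFieldNormedType.Exports.
Import ComplexField.Normc.
Local Open Scope classical_set_scope.
Local Open Scope ring_scope.
Local Open Scope complex_scope.
Set Implicit Arguments.
Unset Strict Implicit.
Unset Printing Implicit Defensive.

(** The infinite product is controlled by the value of its symbol at 1 only.
Since mt is positive, b(1) = 0 and b(-1) = 1, so T(1) is the quark symbol at 1,
a lower triangular matrix with diagonal 2^-i ([quark_symbol_trig],
[quark_symbol_diag]). Its conjugate transposed inverse, the dual symbol at 1, is
upper triangular with diagonal 2^i ([dual_symbol_at1]). Write M(t) for the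
scaled factor 2^-p At(e^{-it}). Then M(0) is upper triangular with last diagonal
entry 1 and all other diagonal entries at most 1/2, so that some weighted
supremum norm gives it operator norm at most 1 ([triangular_weight]). As M is
Lipschitz, M(t) has norm at most exp(L|t|), and the partial products
P_n(xi) = M(xi/2) ... M(xi/2^n) have norm at most exp(L|xi|) uniformly in n.
With M(0) v = v this makes the increments of P_n(xi) v decay geometrically,
hence the limit g exists ([partial_product_cvg]). Combining the exponential
bound for |xi| <= 2 with P_{n+1}(xi) = M(xi/2) P_n(xi/2) and the boundedness of
M gives a bound by a power of max(1, |xi|), uniform in n
([partial_product_le_poly]).

A measurable function of polynomial growth pairs with every rapidly decreasing
continuous function, and the Fourier transform of a Schwartz function is
rapidly decreasing with constants given by Schwartz seminorms
([normc_fourier_schwartz], by integration by parts). So g is a tempered function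
and each component of Phi is tempered.

The support is bounded because every component of P_n v is a trigonometric
polynomial whose frequencies lie in a fixed interval [-N, N]
([partial_product_trigpoly]), so that its inverse transform is a sum of point
masses in [-N, N]. By dominated convergence it suffices to show that the integral
of e^{-i x0 xi} (F h)(xi) is 0 whenever h vanishes near x0, where F h is the
inverse transform of h. This follows by division: k = h/(x - x0) is again smooth
and rapidly decreasing, and the integrand is, up to the factor i, the derivative
of e^{-i x0 xi} (F k)(xi), a function that tends to 0 at infinity
([cintegral_fourier_vanish]).

Refinability is the limit relation g(2 xi) = M(xi) g(xi)
([infinite_product_refine]) read through the Fourier transform: the dilation
y = 2x - k turns into the modulation by e^{-ik xi}, and the p derivatives
produce the scaling factor 2^-p ([spectral_derivative_refinable]). *)

Local Notation normc := (@ComplexField.Normc.normc _).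
Local Notation iC := (Complex 0 1).

(** * Affine changes of variable and an integrable weight *)

Section RealIntegrals.
Context {R : realType}.
Notation mu := (@lebesgue_measure R).

Lemma continuous_affine (a c : R) : continuous (fun x : R => a * x + c).
Proof.
by move=> x; apply: cvgD; [apply: cvgM; [exact: cvg_cst|exact: cvg_id]|exact: cvg_cst].
Qed.

(** Lebesgue measure is a times its own image under x -> a x + c, as one checks on
half-open intervals. *)
Lemma ge0_integral_affine (a c : R) (f : R -> \bar R) : 0 < a ->
  measurable_fun [set: R] f -> (forall x, (0 <= f x)%E) ->
  (\int[mu]_x f x = a%:E * \int[mu]_x f (a * x + c)%R)%E.
Proof.
move=> a0 mf f0.
pose phi (x : R) : R := a * x + c.
have cphi : continuous phi := @continuous_affine a c.
have mphi : measurable_fun [set: measurableTypeR R] (phi : measurableTypeR R -> measurableTypeR R).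
  exact: continuous_measurable_fun cphi.
pose pf : {measure set (measurableTypeR R) -> \bar R} :=
  pushforward mu (phi : measurableTypeR R -> measurableTypeR R).
pose nu : {measure set (measurableTypeR R) -> \bar R} :=
  mscale (NngNum (ltW a0)) (pf mphi).
have munu A : measurable A -> mu A = nu A.
  apply: lebesgue_measure_unique => X /ocitvP [->|[[u v] /= uv ->]].
    by rewrite !measure0.
  have E : phi @^-1` [set` `]u, v]] = [set` `](u - c) / a, (v - c) / a]].
    rewrite predeqE => x /=; rewrite !in_itv /= /phi.
    by rewrite ltr_pdivrMr // ler_pdivlMr // ltrBlDr lerBrDr (mulrC x).
  have uv' : (u - c) / a < (v - c) / a by rewrite ltr_pM2r ?invr_gt0 // ltrD2r.
  rewrite /nu /= /pf /mscale /= /pushforward E.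
  rewrite !lebesgue_measure_itv /= !lte_fin uv uv' !EFinN -!EFinD.
  rewrite -EFinM; congr EFin; field; lra.
rewrite (eq_measure_integral nu) => [|A mA _]; last exact: munu.
rewrite ge0_integral_mscale //.
by rewrite ge0_integral_pushforward.
Qed.

Lemma integrable_affine (a c : R) (f : R -> R) : 0 < a ->
  measurable_fun [set: R] f ->
  mu.-integrable setT (EFin \o f) <->
  mu.-integrable setT (EFin \o (fun x => f (a * x + c))).
Proof.
move=> a0 mf.
have mfa : measurable_fun [set: R] (fun x : R => f (a * x + c)).
  exact: (measurableT_comp mf (continuous_measurable_fun (@continuous_affine a c))).
have E : (\int[mu]_x `|(f x)%:E| = a%:E * \int[mu]_x `|(f (a * x + c)%R)%:E|)%E.
  rewrite -(@ge0_integral_affine a c (fun x => `|(f x)%:E|%E)) //.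
  by apply: measurableT_comp => //; exact/measurable_EFinP.
have I0 : (0 <= \int[mu]_x `|(f (a * x + c)%R)%:E|)%E by exact: integral_ge0.
have [h1 h2] : (\int[mu]_x `|(f x)%:E| < +oo <-> \int[mu]_x `|(f (a * x + c)%R)%:E| < +oo)%E.
  rewrite E; move: I0; case: (\int[mu]_x `|(f (a * x + c)%R)%:E|)%E => [r||] // _.
    by rewrite -EFinM !ltry.
  by rewrite gt0_muley // lte_fin.
split=> /integrableP[_ h]; apply/integrableP; split; try exact/measurable_EFinP.
  exact: h1.
exact: h2.
Qed.

Lemma Rintegral_affine (a c : R) (f : R -> R) : 0 < a ->
  mu.-integrable setT (EFin \o f) ->
  \int[mu]_x f x = a * \int[mu]_x f (a * x + c).
Proof.
move=> a0 fi.
have fi' : mu.-integrable setT (EFin \o (fun x => f (a * x + c))).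
  have mf : measurable_fun [set: R] f by apply/measurable_EFinP; exact: (measurable_int mu fi).
  by have [h _] := integrable_affine c a0 mf; exact: h.
rewrite /Rintegral.
have mf := measurable_int _ fi.
rewrite integralE [in RHS]integralE.
rewrite (@ge0_integral_affine a c ((EFin \o f)^\+)%E a0); [|exact/measurable_funepos|by[]].
rewrite (@ge0_integral_affine a c ((EFin \o f)^\-)%E a0); [|exact/measurable_funeneg|by[]].
have E g : mu.-integrable setT (EFin \o g) -> (\int[mu]_x (EFin \o g)^\+ x)%E = (fine (\int[mu]_x (EFin \o g)^\+ x)%E)%:E
    /\ (\int[mu]_x (EFin \o g)^\- x)%E = (fine (\int[mu]_x (EFin \o g)^\- x)%E)%:E.
  move=> gi; by rewrite !fineK //; [exact: (integrable_neg_fin_num measurableT gi)|exact: (integrable_pos_fin_num measurableT gi)].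
have [E1 E2] := E _ fi'.
have -> : (\int[mu]_x (EFin \o f)^\+ (a * x + c)%R = \int[mu]_x (EFin \o (fun x => f (a * x + c)%R))^\+ x)%E by apply: eq_integral => x _; rewrite !funeposE.
have -> : (\int[mu]_x (EFin \o f)^\- (a * x + c)%R = \int[mu]_x (EFin \o (fun x => f (a * x + c)%R))^\- x)%E by apply: eq_integral => x _; rewrite !funenegE.
by rewrite E1 E2 -!EFinM -!EFinB /= mulrBr.
Qed.

Lemma integrable_oneDsqrV :
  mu.-integrable setT (EFin \o (fun x : R => (oneDsqr x)^-1)).
Proof.
have cw : continuous (fun x : R => (oneDsqr x)^-1) by exact: continuous_oneDsqrV.
apply/integrableP; split.
  by apply/measurable_EFinP; exact: continuous_measurable_fun cw.
have E : (\int[mu]_x (oneDsqr x)^-1%:E = pi%:E)%E.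
  rewrite ge0_symfun_integralT.
  - by rewrite -set_itvcy integral0y_oneDsqr -EFinM; congr EFin; field.
  - by move=> x; rewrite invr_ge0; exact: le_trans ler01 (oneDsqr_ge1 _).
  - exact: cw.
  - by move=> x; rewrite /= /oneDsqr sqrrN.
under eq_integral => x _.
  rewrite /= ger0_norm ?invr_ge0 ?(le_trans ler01 (oneDsqr_ge1 _)) //.
  over.
by rewrite E ltry.
Qed.
End RealIntegrals.

(** * Complex-valued functions of a real variable *)

Section ComplexBasics.
Context {R : realType}.
Local Notation C := R[i].
Local Notation Re := (@complex.Re R).
Local Notation Im := (@complex.Im R).
Implicit Types x y z : C.

Lemma ReD x y : Re (x + y) = Re x + Re y. Proof. by case: x; case: y. Qed.
Lemma ImD x y : Im (x + y) = Im x + Im y. Proof. by case: x; case: y. Qed.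
Lemma ReN x : Re (- x) = - Re x. Proof. by case: x. Qed.
Lemma ImN x : Im (- x) = - Im x. Proof. by case: x. Qed.
Lemma ReM x y : Re (x * y) = Re x * Re y - Im x * Im y.
Proof. by case: x; case: y. Qed.
Lemma ImM x y : Im (x * y) = Re x * Im y + Im x * Re y.
Proof. by case: x; case: y. Qed.
Lemma complexP x y : Re x = Re y -> Im x = Im y -> x = y.
Proof. by case: x y => [a b] [c d] /= -> ->. Qed.

Lemma normc_ge0 z : 0 <= normc z.
Proof. by case: z => a b; exact: sqrtr_ge0. Qed.
Lemma Re_le_normc z : `|Re z| <= normc z.
Proof. by case: z => a b /=; rewrite -sqrtr_sqr ler_sqrt ?lerDl ?addr_ge0 ?sqr_ge0. Qed.
Lemma Im_le_normc z : `|Im z| <= normc z.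
Proof. by case: z => a b /=; rewrite -sqrtr_sqr ler_sqrt ?lerDr ?addr_ge0 ?sqr_ge0. Qed.
Lemma normc_le_ReIm z : normc z <= `|Re z| + `|Im z|.
Proof.
case: z => a b /=.
rewrite -[leRHS]ger0_norm ?addr_ge0 // -[leRHS]sqrtr_sqr ler_sqrt ?sqr_ge0 //.
rewrite sqrrD !real_normK ?num_real // [leRHS]addrAC lerDl mulrn_wge0 // mulr_ge0 //.
Qed.
Lemma normc_real (a : R) : normc a%:C = `|a|.
Proof. by rewrite /= expr0n /= addr0 sqrtr_sqr. Qed.
Lemma normcN x : normc (- x) = normc x.
Proof. by case: x => a b /=; rewrite !sqrrN. Qed.
Lemma ler_normc_sum (I : Type) (s : seq I) (P : pred I) (F : I -> C) :
  normc (\sum_(i <- s | P i) F i) <= \sum_(i <- s | P i) normc (F i).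
Proof.
elim/big_ind2: _ => //; first by rewrite normc0.
by move=> a b c d ab cd; rewrite (le_trans (le_normcD _ _)) // lerD.
Qed.
Lemma normcX x n : normc (x ^+ n) = normc x ^+ n.
Proof. by elim: n => [|n IH]; rewrite ?expr0 ?normc1 // !exprS normcM IH. Qed.

Lemma expi0 : expi (0 : R) = 1. Proof. by rewrite /expi cos0 sin0. Qed.
Lemma expiD (s t : R) : expi (s + t) = expi s * expi t.
Proof.
apply: complexP; rewrite ?ReM ?ImM /= ?cosD ?sinD //.
by rewrite addrC mulrC [X in _ + X]mulrC addrC.
Qed.
Lemma normc_expi (t : R) : normc (expi t) = 1.
Proof. by rewrite /= cos2Dsin2 sqrtr1. Qed.

End ComplexBasics.

Section ComplexFunctions.
Context {R : realType}.
Local Notation C := R[i].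
Local Notation Re := (@complex.Re R).
Local Notation Im := (@complex.Im R).
Implicit Types f g : R -> C.

Definition ccontinuous (f : R -> C) :=
  continuous (Re \o f) /\ continuous (Im \o f).
Definition cmeasurable (f : R -> C) :=
  measurable_fun [set: R] (Re \o f) /\ measurable_fun [set: R] (Im \o f).

Lemma ccontinuous_measurable f : ccontinuous f -> cmeasurable f.
Proof. by case=> a b; split; exact: continuous_measurable_fun. Qed.

Lemma ccontinuousD f g : ccontinuous f -> ccontinuous g ->
  ccontinuous (fun x => f x + g x).
Proof.
move=> [a b] [c d]; split=> x.
  rewrite (_ : _ \o _ = fun x => Re (f x) + Re (g x)); last by apply/funext=> t /=; rewrite ReD.
  by apply: cvgD; [exact: a|exact: c].
rewrite (_ : _ \o _ = fun x => Im (f x) + Im (g x)); last by apply/funext=> t /=; rewrite ImD.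
by apply: cvgD; [exact: b|exact: d].
Qed.

Lemma ccontinuousM f g : ccontinuous f -> ccontinuous g ->
  ccontinuous (fun x => f x * g x).
Proof.
move=> [a b] [c d]; split=> x.
  rewrite (_ : _ \o _ = fun x => Re (f x) * Re (g x) - Im (f x) * Im (g x)); last first.
    by apply/funext=> t /=; rewrite ReM.
  by apply: cvgB; apply: cvgM; [exact: a|exact: c|exact: b|exact: d].
rewrite (_ : _ \o _ = fun x => Re (f x) * Im (g x) + Im (f x) * Re (g x)); last first.
  by apply/funext=> t /=; rewrite ImM.
by apply: cvgD; apply: cvgM; [exact: a|exact: d|exact: b|exact: c].
Qed.

Lemma ccontinuous_cst (z : C) : ccontinuous (fun=> z).
Proof. by split=> x; apply: cvg_cst. Qed.

Lemma ccontinuous_real (f : R -> R) : continuous f ->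
  ccontinuous (fun x => (f x)%:C).
Proof. by move=> cf; split=> x; [exact: cf|apply: cvg_cst]. Qed.

Lemma ccontinuous_expi (a : R) : ccontinuous (fun x => expi (a * x)).
Proof.
have ca : continuous (fun x : R => a * x) by move=> x; apply: cvgM; [exact: cvg_cst|exact: cvg_id].
split=> x; apply: (@continuous_comp _ _ _ (fun x : R => a * x)); try exact: ca.
  exact: continuous_cos.
exact: continuous_sin.
Qed.

Lemma cmeasurableD f g : cmeasurable f -> cmeasurable g ->
  cmeasurable (fun x => f x + g x).
Proof.
move=> [a b] [c d]; split.
  rewrite (_ : _ \o _ = fun x => Re (f x) + Re (g x)); last by apply/funext=> t /=; rewrite ReD.
  exact: measurable_funD.
rewrite (_ : _ \o _ = fun x => Im (f x) + Im (g x)); last by apply/funext=> t /=; rewrite ImD.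
exact: measurable_funD.
Qed.

Lemma cmeasurableM f g : cmeasurable f -> cmeasurable g ->
  cmeasurable (fun x => f x * g x).
Proof.
move=> [a b] [c d]; split.
  rewrite (_ : _ \o _ = fun x => Re (f x) * Re (g x) - Im (f x) * Im (g x)); last first.
    by apply/funext=> t /=; rewrite ReM.
  by apply: measurable_funB; exact: measurable_funM.
rewrite (_ : _ \o _ = fun x => Re (f x) * Im (g x) + Im (f x) * Re (g x)); last first.
  by apply/funext=> t /=; rewrite ImM.
by apply: measurable_funD; exact: measurable_funM.
Qed.

Lemma ccvg_cmeasurable (u : nat -> R -> C) (g : R -> C) :
  (forall n, cmeasurable (u n)) -> (forall x, ccvg (u^~ x) (g x)) ->
  cmeasurable g.
Proof.
move=> mu cu; split.
  by apply: (@measurable_fun_cvg _ _ R setT (fun n => Re \o u n)) => [n|x _]; [have [] := mu n|have [] := cu x].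
by apply: (@measurable_fun_cvg _ _ R setT (fun n => Im \o u n)) => [n|x _]; [have [] := mu n|have [] := cu x].
Qed.

Lemma cmeasurable_affine (a c : R) f : cmeasurable f ->
  cmeasurable (fun x => f (a * x + c)).
Proof.
have ma := continuous_measurable_fun (@continuous_affine R a c).
by move=> [mr mi]; split; [exact: (measurableT_comp mr ma)|exact: (measurableT_comp mi ma)].
Qed.

Lemma ccvgD (u v : nat -> C) x y : ccvg u x -> ccvg v y ->
  ccvg (fun n => u n + v n) (x + y).
Proof.
move=> [a b] [c d]; split; rewrite ?ReD ?ImD.
  by under eq_fun do rewrite ReD; exact: cvgD.
by under eq_fun do rewrite ImD; exact: cvgD.
Qed.

Lemma ccvgM (u v : nat -> C) x y : ccvg u x -> ccvg v y ->
  ccvg (fun n => u n * v n) (x * y).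
Proof.
move=> [a b] [c d]; split; rewrite ?ReM ?ImM.
  by under eq_fun do rewrite ReM; apply: cvgB; exact: cvgM.
by under eq_fun do rewrite ImM; apply: cvgD; exact: cvgM.
Qed.

Lemma ccvg_cst (z : C) : ccvg (fun=> z) z.
Proof. by split; exact: cvg_cst. Qed.

Lemma ccvg_sum (I : Type) (s : seq I) (u : I -> nat -> C) (l : I -> C) :
  (forall i, ccvg (u i) (l i)) ->
  ccvg (fun n => \sum_(i <- s) u i n) (\sum_(i <- s) l i).
Proof.
move=> ul; elim: s => [|i s IH].
  by rewrite big_nil; under eq_fun do rewrite big_nil; exact: ccvg_cst.
by rewrite big_cons; under eq_fun do rewrite big_cons; exact: ccvgD.
Qed.

Lemma ccvg_unique (u : nat -> C) x y : ccvg u x -> ccvg u y -> x = y.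
Proof.
move=> [a b] [c d]; apply: complexP.
  exact: (cvg_unique (@Rhausdorff R) a c).
exact: (cvg_unique (@Rhausdorff R) b d).
Qed.

(** The factor 2 comes from estimating real and imaginary parts separately. *)
Lemma ccvg_le (u : nat -> C) x (B : R) : ccvg u x ->
  (forall n, normc (u n) <= B) -> normc x <= B *+ 2.
Proof.
move=> [a b] uB; rewrite (le_trans (normc_le_ReIm _)) // mulr2n lerD //.
  apply: (cvgr_to_le (cvg_norm a)).
  by apply: nearW => n; apply: le_trans (Re_le_normc _) (uB n).
apply: (cvgr_to_le (cvg_norm b)).
by apply: nearW => n; apply: le_trans (Im_le_normc _) (uB n).
Qed.
End ComplexFunctions.

(** * Integrals of complex-valued functions *)

Section ComplexIntegrals.
Context {R : realType}.
Local Notation C := R[i].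
Local Notation mu := (@lebesgue_measure R).
Local Notation Re := (@complex.Re R).
Local Notation Im := (@complex.Im R).
Implicit Types f g : R -> C.

(** The reference integrable function 1 / (1 + x^2): the functions integrated below
are dominated by multiples of it, up to affine changes of variable. *)
Definition weight (x : R) : R := (oneDsqr x)^-1.
Definition weight_mass : R := \int[mu]_x weight x.

Lemma weight_ge0 x : 0 <= weight x.
Proof. by rewrite invr_ge0; exact: le_trans ler01 (oneDsqr_ge1 _). Qed.

Lemma weight_mass_ge0 : 0 <= weight_mass.
Proof. by apply: Rintegral_ge0 => x _; exact: weight_ge0. Qed.

Lemma integrableZR (r : R) (h : R -> R) : mu.-integrable setT (EFin \o h) ->
  mu.-integrable setT (EFin \o (fun x => r * h x)).
Proof. by move=> ih; exact: (integrableZl measurableT r ih). Qed.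

Lemma integrable_weight (B : R) :
  mu.-integrable setT (EFin \o (fun x => B * weight x)).
Proof. by apply: integrableZR; exact: integrable_oneDsqrV. Qed.

Lemma le_weight (a B x : R) : a + x ^+ 2 * a <= B -> a <= B * weight x.
Proof.
move=> h; rewrite /weight ler_pdivlMr; last exact: lt_le_trans ltr01 (oneDsqr_ge1 _).
by rewrite /oneDsqr mulrDr mulr1 [a * _]mulrC.
Qed.

Lemma cintegrable_dom f (B : R) : cmeasurable f ->
  (forall x, normc (f x) <= B * weight x) -> cintegrable f.
Proof.
move=> [mr mi] fB; have iB := integrable_weight B; split.
  apply: (le_integrable measurableT _ _ iB); first exact/measurable_EFinP.
  move=> x _ /=; rewrite lee_fin; apply: le_trans (ler_norm _).
  by apply: le_trans (Re_le_normc _) (fB x).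
apply: (le_integrable measurableT _ _ iB); first exact/measurable_EFinP.
move=> x _ /=; rewrite lee_fin; apply: le_trans (ler_norm _).
by apply: le_trans (Im_le_normc _) (fB x).
Qed.

Lemma normc_cintegral_le f (B : R) : cmeasurable f ->
  (forall x, normc (f x) <= B * weight x) ->
  normc (cintegral f) <= 2 * weight_mass * B.
Proof.
move=> mf fB; have [ir ii] := cintegrable_dom mf fB.
have E : \int[mu]_x (B * weight x) = weight_mass * B.
  by rewrite RintegralZl ?[B * _]mulrC //; exact: integrable_oneDsqrV.
rewrite (le_trans (normc_le_ReIm _)) // -mulrA mulr_natl mulr2n -E.
have iB := integrable_weight B.
have aux (h : R -> R) : mu.-integrable setT (EFin \o h) ->
    (forall x, `|h x| <= B * weight x) ->
    `|\int[mu]_x h x| <= \int[mu]_x (B * weight x).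
  move=> ih hB; apply: le_trans (le_normr_Rintegral measurableT ih) _.
  apply: le_Rintegral => //; exact: (integrable_norm ih).
apply: lerD => /=; apply: aux => //= x.
  by apply: le_trans (Re_le_normc _) (fB x).
by apply: le_trans (Im_le_normc _) (fB x).
Qed.

Lemma cintegrableD f g : cintegrable f -> cintegrable g ->
  cintegrable (fun x => f x + g x).
Proof.
move=> [a b] [c d]; split.
  rewrite (_ : EFin \o _ = (fun x => (EFin \o (Re \o f)) x + (EFin \o (Re \o g)) x)%E); last first.
    by apply/funext=> t /=; rewrite ReD.
  exact: integrableD.
rewrite (_ : EFin \o _ = (fun x => (EFin \o (Im \o f)) x + (EFin \o (Im \o g)) x)%E); last first.
  by apply/funext=> t /=; rewrite ImD.
exact: integrableD.
Qed.

Lemma cintegralD f g : cintegrable f -> cintegrable g ->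
  cintegral (fun x => f x + g x) = cintegral f + cintegral g.
Proof.
move=> [a b] [c d]; apply: complexP; rewrite ?ReD ?ImD /= -RintegralD //.
  by apply: eq_Rintegral => x _; rewrite ReD.
by apply: eq_Rintegral => x _; rewrite ImD.
Qed.

Lemma cintegrableZ (c : C) f : cintegrable f ->
  cintegrable (fun x => c * f x).
Proof.
move=> [a b]; split.
  rewrite (_ : EFin \o _ = (fun x => (EFin \o (fun x => (Re c * Re (f x))%R)) x - (EFin \o (fun x => (Im c * Im (f x))%R)) x)%E); last first.
    by apply/funext=> t /=; rewrite ReM EFinB.
  by apply: integrableB => //; exact: integrableZR.
rewrite (_ : EFin \o _ = (fun x => (EFin \o (fun x => (Re c * Im (f x))%R)) x + (EFin \o (fun x => (Im c * Re (f x))%R)) x)%E); last first.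
  by apply/funext=> t /=; rewrite ImM EFinD.
by apply: integrableD => //; exact: integrableZR.
Qed.

Lemma cintegralZ (c : C) f : cintegrable f ->
  cintegral (fun x => c * f x) = c * cintegral f.
Proof.
move=> [a b]; apply: complexP; rewrite ?ReM ?ImM /= -!RintegralZl //.
  rewrite -RintegralB //; try exact: integrableZR.
  by apply: eq_Rintegral => x _; rewrite ReM.
rewrite -RintegralD //; try exact: integrableZR.
by apply: eq_Rintegral => x _; rewrite ImM.
Qed.

Lemma cintegral0 : cintegral (fun=> 0 : C) = 0.
Proof. by rewrite /cintegral /= Rintegral_cst // mul0r. Qed.

Lemma cintegrable0 : cintegrable (fun=> 0 : C).
Proof.
apply: (@cintegrable_dom _ 0); first exact/ccontinuous_measurable/ccontinuous_cst.
by move=> x; rewrite normc0 mul0r.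
Qed.

Lemma cintegrable_sum (I : Type) (s : seq I) (F : I -> R -> C) :
  (forall i, cintegrable (F i)) -> cintegrable (fun x => \sum_(i <- s) F i x).
Proof.
move=> iF; elim: s => [|i s IH].
  by under eq_fun do rewrite big_nil; exact: cintegrable0.
by under eq_fun do rewrite big_cons; exact: cintegrableD.
Qed.

Lemma cintegral_sum (I : Type) (s : seq I) (F : I -> R -> C) :
  (forall i, cintegrable (F i)) ->
  cintegral (fun x => \sum_(i <- s) F i x) = \sum_(i <- s) cintegral (F i).
Proof.
move=> iF; elim: s => [|i s IH].
  by under eq_fun do rewrite big_nil; rewrite cintegral0 big_nil.
under eq_fun do rewrite big_cons.
by rewrite cintegralD // ?IH ?big_cons //; exact: cintegrable_sum.
Qed.

Lemma Rintegral_cvg (v : nat -> R -> R) (h : R -> R) (B : R) :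
  (forall n, measurable_fun [set: R] (v n)) -> measurable_fun [set: R] h ->
  (forall x, v n x @[n --> \oo] --> h x) ->
  (forall n x, `|v n x| <= B * weight x) ->
  \int[mu]_x v n x @[n --> \oo] --> \int[mu]_x h x.
Proof.
move=> mv mh vh vB; have iB := integrable_weight B.
have ih : mu.-integrable setT (EFin \o h).
  apply: (le_integrable measurableT _ _ iB); first exact/measurable_EFinP.
  move=> x _ /=; rewrite lee_fin; apply: le_trans (ler_norm _).
  apply: (cvgr_to_le (cvg_norm (vh x))).
  by apply: nearW => n; exact: vB.
apply: fine_cvg; rewrite fineK; last exact: (integrable_fin_num measurableT ih).
apply: (@dominated_cvg _ _ _ mu setT measurableT (fun n x => (v n x)%:E) _ (EFin \o (fun x => B * weight x))) => //=.
- by move=> n; apply/measurable_EFinP; exact: mv.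
- by move=> x _; apply: cvg_EFin; [exact: nearW|exact: vh].
by move=> n x _; rewrite lee_fin.
Qed.

Lemma cintegral_cvg (u : nat -> R -> C) g (B : R) :
  (forall n, cmeasurable (u n)) -> (forall x, ccvg (u^~ x) (g x)) ->
  (forall n x, normc (u n x) <= B * weight x) ->
  ccvg (fun n => cintegral (u n)) (cintegral g).
Proof.
move=> mu_ ug uB.
have mg := ccvg_cmeasurable mu_ ug.
split => /=; apply: (@Rintegral_cvg _ _ B).
- by move=> n; have [] := mu_ n.
- by have [] := mg.
- by move=> x; have [] := ug x.
- by move=> n x; exact: le_trans (Re_le_normc _) (uB n x).
- by move=> n; have [] := mu_ n.
- by have [] := mg.
- by move=> x; have [] := ug x.
- by move=> n x; exact: le_trans (Im_le_normc _) (uB n x).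
Qed.

Lemma cintegrable_affine (a c : R) f : 0 < a -> cmeasurable f ->
  cintegrable f <-> cintegrable (fun x => f (a * x + c)).
Proof.
by move=> a0 [mr mi]; split=> -[ir ii]; split;
  [move/(integrable_affine c a0 mr): ir|move/(integrable_affine c a0 mi): ii
  |apply/(integrable_affine c a0 mr)|apply/(integrable_affine c a0 mi)].
Qed.

Lemma cintegral_affine (a c : R) f : 0 < a -> cintegrable f ->
  cintegral f = a%:C * cintegral (fun x => f (a * x + c)).
Proof.
move=> a0 [ir ii]; apply: complexP; rewrite ?ReM ?ImM /= mul0r ?subr0 ?addr0.
  exact: (Rintegral_affine c a0 ir).
exact: (Rintegral_affine c a0 ii).
Qed.
End ComplexIntegrals.
Arguments weight_mass {R}.

(** * Derivatives with zero integral *)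

Section DerivativeIntegral.
Context {R : realType}.
Local Notation C := R[i].
Local Notation mu := (@lebesgue_measure R).
Local Notation Re := (@complex.Re R).
Local Notation Im := (@complex.Im R).

(** The integral of F' over [-n, n] is F n - F (- n), which is O(1/n). *)
Lemma Rintegral_derive_eq0 (F F' : R -> R) (B : R) :
  (forall x : R, is_derive x 1 F (F' x)) -> continuous F' ->
  (forall x, `|F' x| <= B * weight x) -> (forall x, `|x| * `|F x| <= B) ->
  \int[mu]_x F' x = 0.
Proof.
move=> dF cF' F'B FB.
have cF : continuous F.
  move=> x; apply: differentiable_continuous; apply/derivable1_diffP.
  by have := dF x => dFx; exact: ex_derive.
pose D (n : nat) := `[- n.+1%:R, n.+1%:R]%classic : set R.
pose u n := F' \_ (D n).
have mF' := continuous_measurable_fun cF'.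
have H1 : \int[mu]_x u n x @[n --> \oo] --> \int[mu]_x F' x.
  apply: (@Rintegral_cvg _ _ _ B).
  - move=> n; have mD : measurable (D n) by exact: measurable_itv.
    by apply/(measurable_restrictT _ mD); exact: (measurable_funTS mF').
  - exact: mF'.
  - move=> x; apply: cvg_near_cst.
    exists (Num.truncn `|x|) => // n /= xn; rewrite /u patchE ifT // inE /D /= in_itv /=.
    rewrite -ler_norml; apply: ltW; apply: lt_le_trans (truncnS_gt _) _.
    by rewrite ler_nat ltnS.
  - move=> n x; rewrite /u patchE; case: ifP => // _.
    by rewrite normr0; exact: le_trans (F'B x).
have E n : \int[mu]_x u n x = F n.+1%:R - F (- n.+1%:R).
  rewrite /u -Rintegral_mkcond /Rintegral (@continuous_FTC2 _ F' F) //.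
  - by rewrite (@lt_trans _ _ 0) // oppr_lt0.
  - exact: continuous_subspaceT.
  - split; first by move=> x _; have := dF x => dFx; exact: ex_derive.
      by apply: cvg_at_right_filter; exact: cF.
    by apply: cvg_at_left_filter; exact: cF.
  - by move=> x _; rewrite derive1E; have := dF x => dFx; exact: derive_val.
have H2 : \int[mu]_x u n x @[n --> \oo] --> (0 : R).
  apply: norm_cvg0; apply: (@squeeze_cvgr _ _ _ _ (cst 0) (fun n => (2 * B) * (harmonic n))).
  - apply: nearW => n /=; rewrite normr_ge0 /= E.
    have h (s : R) : `|s| = n.+1%:R -> `|F s| <= B * n.+1%:R^-1.
      by move=> sn; rewrite ler_pdivlMr // mulrC -sn FB.
    have n0 : `|n.+1%:R : R| = n.+1%:R by rewrite ger0_norm.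
    rewrite (le_trans (ler_normB _ _)) // -mulrA mulr_natl mulr2n lerD // h //.
    by rewrite normrN.
  - exact: cvg_cst.
  - rewrite -[X in _ --> X](mulr0 (2 * B)); apply: cvgM; [exact: cvg_cst|exact: cvg_harmonic].
exact: (cvg_unique (@Rhausdorff R) H1 H2).
Qed.

Definition is_cderive_at (f : R -> C) (x : R) (d : C) :=
  is_derive x 1 (Re \o f) (Re d) /\ is_derive x 1 (Im \o f) (Im d).

(** Unlike [cderiven], whose value is meaningful only where a derivative exists,
this relation carries the differentiability with it. *)
Definition is_cderive (f f' : R -> C) := forall x : R, is_cderive_at f x (f' x).

Lemma is_cderive_continuous f f' : is_cderive f f' -> ccontinuous f.
Proof.
move=> df; split=> x; apply: differentiable_continuous; apply/derivable1_diffP.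
  by have [dfx _] := df x; exact: ex_derive.
by have [_ dfx] := df x; exact: ex_derive.
Qed.

Lemma is_cderiveM_at f g x df dg : is_cderive_at f x df -> is_cderive_at g x dg ->
  is_cderive_at (fun x => f x * g x) x (df * g x + f x * dg).
Proof.
move=> [? ?] [? ?]; split.
  rewrite (_ : Re \o _ = (Re \o f) * (Re \o g) - (Im \o f) * (Im \o g)); last first.
    by apply/funext=> t /=; rewrite ReM.
  apply: is_derive_eq; rewrite ReD !ReM /GRing.scale /=.
  move: (Re df) (Im df) (Re dg) (Im dg) (Re (f x)) (Im (f x)) (Re (g x)) (Im (g x)) => *; ring.
rewrite (_ : Im \o _ = (Re \o f) * (Im \o g) + (Im \o f) * (Re \o g)); last first.
  by apply/funext=> t /=; rewrite ImM.
apply: is_derive_eq; rewrite ImD !ImM /GRing.scale /=.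
move: (Re df) (Im df) (Re dg) (Im dg) (Re (f x)) (Im (f x)) (Re (g x)) (Im (g x)) => *; ring.
Qed.

Lemma is_cderiveM f f' g g' : is_cderive f f' -> is_cderive g g' ->
  is_cderive (fun x => f x * g x) (fun x => f' x * g x + f x * g' x).
Proof. by move=> df dg x; exact: is_cderiveM_at. Qed.

Lemma is_cderiveZ (c : C) f f' : is_cderive f f' ->
  is_cderive (fun x => c * f x) (fun x => c * f' x).
Proof.
move=> df; have dc : is_cderive (fun=> c) (fun=> 0).
  by move=> x; split => /=; exact: is_derive_cst.
have := is_cderiveM dc df; congr is_cderive; apply/funext => x; by rewrite mul0r add0r.
Qed.

Lemma is_cderive_expi (a : R) :
  is_cderive (fun x => expi (a * x)) (fun x => (a%:C * iC) * expi (a * x)).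
Proof.
move=> x.
have da : is_derive x 1 (fun x : R => a * x) a.
  by apply: is_derive_eq; rewrite /GRing.scale /= mulr1.
have dsin := is_derive1_comp (f := @sin R) (is_derive_sin (a * x)) da.
have dcos := is_derive1_comp (f := @cos R) (is_derive_cos (a * x)) da.
split => /=.
  by apply: (is_derive_eq dcos); rewrite /=; ring.
by apply: (is_derive_eq dsin); rewrite /=; ring.
Qed.

Lemma cintegral_derive_eq0 (f f' : R -> C) (B : R) :
  is_cderive f f' -> ccontinuous f' ->
  (forall x, normc (f' x) <= B * weight x) ->
  (forall x, `|x| * normc (f x) <= B) -> cintegral f' = 0.
Proof.
move=> df [c1 c2] f'B fB; apply: complexP => /=.
  apply: (@Rintegral_derive_eq0 (Re \o f) (Re \o f') B) => // x.
  - by have [] := df x.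
  - by apply: le_trans (Re_le_normc _) (f'B x).
  by apply: le_trans (fB x); apply: ler_wpM2l => //; exact: Re_le_normc.
apply: (@Rintegral_derive_eq0 (Im \o f) (Im \o f') B) => // x.
- by have [] := df x.
- by apply: le_trans (Im_le_normc _) (f'B x).
by apply: le_trans (fB x); apply: ler_wpM2l => //; exact: Im_le_normc.
Qed.
End DerivativeIntegral.

(** * Fourier transforms of Schwartz functions *)

Section Fourier.
Context {R : realType}.
Local Notation C := R[i].
Implicit Types f g : R -> C.

(** The unnormalized inverse transform: the sign of the exponent and the missing
factor are those that relate it to [inverse_fourier]. *)
Definition fourier f (xi : R) : C := cintegral (fun x => f x * expi (xi * x)).

Definition dominated (B : R) f := cmeasurable f /\ forall x, normc (f x) <= B * weight x.

Lemma dominated_ge0 B f : dominated B f -> 0 <= B.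
Proof.
move=> [_ fB]; have := le_trans (normc_ge0 _) (fB 0).
by rewrite /weight /oneDsqr expr0n /= addr0 invr1 mulr1.
Qed.

Lemma dominatedW B1 B2 f : B1 <= B2 -> dominated B1 f -> dominated B2 f.
Proof.
move=> B12 [mf fB]; split=> // x; apply: le_trans (fB x) _.
by rewrite ler_wpM2r // weight_ge0.
Qed.

Lemma dominated_cintegrable B f : dominated B f -> cintegrable f.
Proof. by move=> [mf fB]; exact: cintegrable_dom mf fB. Qed.

Lemma dominated_modulate B f (xi : R) : dominated B f ->
  dominated B (fun x => f x * expi (xi * x)).
Proof.
move=> [mf fB]; split.
  by apply: cmeasurableM => //; exact/ccontinuous_measurable/ccontinuous_expi.
by move=> x; rewrite normcM normc_expi mulr1.
Qed.

Lemma normc_fourier_le B f (xi : R) : dominated B f ->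
  normc (fourier f xi) <= 2 * weight_mass * B.
Proof. by move=> /(dominated_modulate xi)[mf fB]; exact: normc_cintegral_le. Qed.

Lemma fourier_continuous B f : dominated B f -> ccontinuous (fourier f).
Proof.
move=> domf.
have H xi (u : nat -> R) : u n @[n --> \oo] --> xi ->
    ccvg (fun n => fourier f (u n)) (fourier f xi).
  move=> uxi; apply: (@cintegral_cvg _ (fun n x => f x * expi (u n * x)) _ B).
  - by move=> n; have [] := dominated_modulate (u n) domf.
  - move=> x; apply: ccvgM; first exact: ccvg_cst.
    have ux : u n * x @[n --> \oo] --> xi * x by apply: cvgM => //; exact: cvg_cst.
    split.
      by apply: (cvg_comp (fun n => u n * x) (@cos R) ux); exact: continuous_cos.
    by apply: (cvg_comp (fun n => u n * x) (@sin R) ux); exact: continuous_sin.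
  by move=> n; have [] := dominated_modulate (u n) domf.
split=> xi; apply/(@cvg_nbhsP _ R^o) => u /H[h1 h2]; [exact: h1|exact: h2].
Qed.

Lemma normr_weight_le1 (x : R) : `|x| * weight x <= 1.
Proof.
rewrite /weight ler_pdivrMr ?mul1r; last exact: lt_le_trans ltr01 (oneDsqr_ge1 _).
rewrite /oneDsqr -[x ^+ 2]real_normK ?num_real //.
have [h|h] := lerP `|x| 1; first by rewrite (le_trans h) // lerDl sqr_ge0.
by rewrite (@le_trans _ _ (`|x| ^+ 2)) ?lerDr // ler_eXnr // ltW.
Qed.

Lemma normc_iC : normc (iC : C) = 1.
Proof. by rewrite /= expr0n expr1n add0r sqrtr1. Qed.

(** Integration by parts: the derivative of f(x) e^{i x xi} has zero integral. *)
Lemma fourier_derive B f f' (xi : R) : is_cderive f f' -> ccontinuous f' ->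
  dominated B f -> dominated B f' ->
  fourier f' xi = - (xi%:C * iC) * fourier f xi.
Proof.
move=> df cf' domf domf'.
have B0 := dominated_ge0 domf.
have cf := is_cderive_continuous df.
have ce := ccontinuous_expi xi.
have df' := dominated_modulate xi domf'; have dff := dominated_modulate xi domf.
have [i1 i2] := (dominated_cintegrable df', dominated_cintegrable dff).
have du := is_cderiveM df (is_cderive_expi xi).
have := @cintegral_derive_eq0 R _ _ (B * (1 + `|xi|)) du.
have -> : (fun x => f' x * expi (xi * x) + f x * (xi%:C * iC * expi (xi * x))) =
    (fun x => f' x * expi (xi * x) + (xi%:C * iC) * (f x * expi (xi * x))).
  by apply/funext => x; rewrite mulrCA.
move=> H; have /eqP : cintegral (fun x => f' x * expi (xi * x) + (xi%:C * iC) * (f x * expi (xi * x))) = 0.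
  apply: H.
  - apply: ccontinuousD; apply: ccontinuousM => //.
      exact: ccontinuous_cst.
    exact: ccontinuousM.
  - move=> x; apply: le_trans (le_normcD _ _) _.
    rewrite mulrDr mulr1 mulrDl; apply: lerD; first by have [_] := df'; apply.
    rewrite [f x * _]mulrCA normcM (normcM _ iC) normc_real normc_iC mulr1.
    by rewrite [leRHS]mulrAC [leRHS]mulrC; apply: ler_wpM2l => //; have [_] := dff; apply.
  - move=> x; rewrite normcM normc_expi mulr1.
    have [_ fB] := domf.
    apply: le_trans (_ : `|x| * (B * weight x) <= _).
      by apply: ler_wpM2l.
    rewrite mulrCA; apply: ler_wpM2l => //.
    by apply: le_trans (normr_weight_le1 x) _; rewrite lerDl.
rewrite cintegralD //; last exact: cintegrableZ.
by rewrite cintegralZ // addr_eq0 /fourier => /eqP ->; rewrite mulNr.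
Qed.
End Fourier.

Section Schwartz.
Context {R : realType}.
Local Notation C := R[i].
Implicit Types f g : R -> C.

Lemma seminorm_ub f k n x : schwartz f ->
  `|x| ^+ k * normc (cderiven n f x) <= seminorm k n f.
Proof.
move=> [_ /(_ k n)[M fM]]; apply: sup_upper_bound; last by exists x.
split; first by exists (`|0 : R| ^+ k * normc (cderiven n f 0)), 0.
by exists M => _ [y _ <-]; exact: fM.
Qed.

Lemma seminorm_ge0 f k n : schwartz f -> 0 <= seminorm k n f.
Proof.
move=> sf; apply: le_trans (seminorm_ub k n 0 sf).
by rewrite mulr_ge0 ?exprn_ge0 // normc_ge0.
Qed.

Lemma schwartz_is_cderive f n : schwartz f ->
  is_cderive (cderiven n f) (cderiven n.+1 f).
Proof.
move=> [df _] x; have [d1 d2] := df n x; split.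
  by apply: DeriveDef; [exact: d1|rewrite /= -derive1E].
by apply: DeriveDef; [exact: d2|rewrite /= -derive1E].
Qed.

Lemma schwartz_continuous f n : schwartz f -> ccontinuous (cderiven n f).
Proof. by move=> /(schwartz_is_cderive n)/is_cderive_continuous. Qed.

Lemma schwartz_dominated f n : schwartz f ->
  dominated (seminorm 0 n f + seminorm 2 n f) (cderiven n f).
Proof.
move=> sf; split; first exact/ccontinuous_measurable/schwartz_continuous.
move=> x; apply: le_weight; apply: lerD.
  by have := seminorm_ub 0 n x sf; rewrite expr0 mul1r.
by have := seminorm_ub 2 n x sf; rewrite real_normK ?num_real.
Qed.

(** The left-hand side is the modulus of the transform of the derivative of order
n + k, so it is bounded by the integral of that derivative. *)
Lemma normc_fourier_schwartz f k n (xi : R) : schwartz f ->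
  `|xi| ^+ k * normc (fourier (cderiven n f) xi) <=
  2 * weight_mass * (seminorm 0 (n + k) f + seminorm 2 (n + k) f).
Proof.
move=> sf; have <- : normc (fourier (cderiven (n + k) f) xi) = `|xi| ^+ k * normc (fourier (cderiven n f) xi).
  elim: k => [|k IH]; first by rewrite addn0 expr0 mul1r.
  rewrite addnS exprS -mulrA -IH.
  pose B1 := seminorm 0 (n + k) f + seminorm 2 (n + k) f.
  pose B2 := seminorm 0 (n + k).+1 f + seminorm 2 (n + k).+1 f.
  have D1 : dominated (Num.max B1 B2) (cderiven (n + k) f).
    by apply: dominatedW (schwartz_dominated (n + k) sf); rewrite le_max lexx.
  have D2 : dominated (Num.max B1 B2) (cderiven (n + k).+1 f).
    by apply: dominatedW (schwartz_dominated (n + k).+1 sf); rewrite le_max lexx orbT.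
  have E := fourier_derive xi (schwartz_is_cderive (n + k) sf)
    (schwartz_continuous (n + k).+1 sf) D1 D2.
  by rewrite (congr1 normc E) normcM normcN normcM normc_real normc_iC mulr1.
apply: normc_fourier_le; exact: schwartz_dominated.
Qed.
End Schwartz.

(** * Orthogonality to characters outside the support *)

Section FourierVanish.
Context {R : realType}.
Local Notation C := R[i].
Local Notation Re := (@complex.Re R).
Local Notation Im := (@complex.Im R).
Local Notation mu := (@lebesgue_measure R).
Implicit Types f g : R -> C.

(** Differentiation under the integral sign. *)
Lemma is_cderive_fourier B f : dominated B f ->
  dominated B (fun x => x%:C * iC * f x) ->
  is_cderive (fourier f) (fourier (fun x => x%:C * iC * f x)).
Proof.
move=> domf domxf xi.
have B0 := dominated_ge0 domf.
have aux (h : R -> R -> R) (h' : R -> R -> R) :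
    (forall t, mu.-integrable setT (EFin \o h t)) ->
    (forall t x : R, is_derive t 1 (h^~ x) (h' t x)) ->
    (forall t x, `|h' t x| <= B * weight x) ->
    is_derive xi 1 (fun t : R => \int[mu]_x h t x) (\int[mu]_x h' xi x).
  move=> ih dh h'B.
  have I1 : `](xi - 1), (xi + 1)[%classic xi.
    by rewrite /= in_itv /= ltrBlDr ltrDl ltr01.
  have E t x : partial1of2 h t x = h' t x.
    by rewrite partial1of2E; have dhx := dh t x; exact: derive_val.
  have dh' t x (_ : `](xi - 1), (xi + 1)[%classic t) (_ : [set: R] x) : derivable (h^~ x) t 1.
    by have dhx := dh t x; exact: ex_derive.
  have ih' t (_ : `](xi - 1), (xi + 1)[%classic t) := ih t.
  have G0 x : 0 <= B * weight x by rewrite mulr_ge0 ?weight_ge0.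
  have GB t x (_ : `](xi - 1), (xi + 1)[%classic t) (_ : [set: R] x) : `|partial1of2 h t x| <= B * weight x.
    by rewrite E.
  apply: DeriveDef.
    exact: (derivable_under_integral measurableT I1 ih' dh' G0 (integrable_weight B) GB).
  rewrite -derive1E (differentiation_under_integral measurableT I1 ih' dh' G0 (integrable_weight B) GB).
  by apply: eq_Rintegral => x _; exact: E.
have dh t x : is_cderive_at (fun t => f x * expi (t * x)) t (x%:C * iC * f x * expi (t * x)).
  have := is_cderiveZ (f x) (is_cderive_expi x) t.
  rewrite /= mulrCA mulrA [t * x]mulrC; congr is_cderive_at.
  by apply/funext => s; rewrite [s * x]mulrC.
have dm t := dominated_modulate t domxf.
split => /=.
  apply: (aux (fun t x => Re (f x * expi (t * x))) (fun t x => Re (x%:C * iC * f x * expi (t * x)))) => t.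
  - by have [] := dominated_cintegrable (dominated_modulate t domf).
  - by move=> x; have [] := dh t x.
  - by move=> x; have [_ fB] := dm t; exact: le_trans (Re_le_normc _) (fB x).
apply: (aux (fun t x => Im (f x * expi (t * x))) (fun t x => Im (x%:C * iC * f x * expi (t * x)))) => t.
- by have [] := dominated_cintegrable (dominated_modulate t domf).
- by move=> x; have [] := dh t x.
- by move=> x; have [_ fB] := dm t; exact: le_trans (Im_le_normc _) (fB x).
Qed.

Lemma near_dist_lt (x0 delta x : R) : `|x - x0| < delta ->
  \forall t \near x, `|t - x0| < delta.
Proof.
move=> xd; have ct : `|t - x0| @[t --> x] --> `|x - x0|.
  by apply: cvg_norm; apply: cvgB; [exact: cvg_id|exact: cvg_cst].
by apply: (cvgr_lt _ ct).
Qed.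

Definition vanishes_near (x0 delta : R) f := forall x, `|x - x0| < delta -> f x = 0.

Variables x0 delta : R.
Hypothesis delta_gt0 : 0 < delta.
Local Notation vanish := (vanishes_near x0 delta).

(** The quotient by x - x0. The convention 0^-1 = 0 makes it vanish at x0, which is
the right value as soon as f vanishes near x0. *)
Definition divide_at f (x : R) : C := ((x - x0)^-1)%:C * f x.

Lemma vanish_divide f : vanish f -> vanish (divide_at f).
Proof. by move=> f0 x /f0; rewrite /divide_at => ->; rewrite mulr0. Qed.

(** Writing the quotient rule with two nested quotients lets the lemma be applied
to its own conclusion, which is how continuity of the derivative is obtained. *)
Lemma is_cderive_divide f f' : is_cderive f f' -> vanish f -> vanish f' ->
  is_cderive (divide_at f) (fun x => divide_at f' x - divide_at (divide_at f) x).
Proof.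
move=> df f0 f'0 x.
have [xd|xd] := ltP `|x - x0| delta.
  have -> : divide_at f' x - divide_at (divide_at f) x = 0.
    by rewrite !vanish_divide ?subr0 //; exact: vanish_divide.
  have nz : \near x, divide_at f x = 0.
    by apply: filterS (near_dist_lt xd) => t; exact: vanish_divide.
  split; apply: (@near_eq_is_derive _ _ _ (cst 0)); try exact: is_derive_cst.
    by apply: filterS nz => t /= ->.
  by apply: filterS nz => t /= ->.
have xx0 : x - x0 != 0 by rewrite -normr_gt0 (lt_le_trans delta_gt0).
have dr : is_cderive_at (fun x => ((x - x0)^-1)%:C) x (- ((x - x0) ^- 2)%:C).
  have dx : is_derive x 1 (fun x : R => x - x0) 1.
    by apply: is_derive_eq; rewrite subr0.
  split; last by rewrite ImN /= oppr0; exact: is_derive_cst.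
  rewrite ReN /=.
  have := @is_deriveV R (fun x : R => x - x0) x 1 1 xx0 dx; rewrite /GRing.scale /= mulr1; apply.
have := is_cderiveM_at dr (df x); rewrite /divide_at; congr is_cderive_at.
rewrite addrC mulrA mulNr -rmorphM /= -expr2 exprVn //.
Qed.

Lemma normc_divide f x : vanish f -> normc (divide_at f x) <= delta^-1 * normc (f x).
Proof.
move=> f0; rewrite normcM normc_real normfV.
have [xd|xd] := ltP `|x - x0| delta; first by rewrite f0 // normc0 !mulr0.
by rewrite ler_wpM2r ?normc_ge0 // lef_pV2 ?posrE // (lt_le_trans delta_gt0).
Qed.

Lemma dominated_divide B f : vanish f -> ccontinuous (divide_at f) ->
  dominated B f -> dominated (delta^-1 * B) (divide_at f).
Proof.
move=> f0 cf [_ fB]; split; first exact: ccontinuous_measurable.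
move=> x; apply: le_trans (normc_divide x f0) _; rewrite -mulrA.
by rewrite ler_wpM2l // invr_ge0 ltW.
Qed.

Lemma dominatedD B1 B2 f g : dominated B1 f -> dominated B2 g ->
  dominated (B1 + B2) (fun x => f x + g x).
Proof.
move=> [mf fB] [mg gB]; split; first exact: cmeasurableD.
by move=> x; rewrite mulrDl (le_trans (le_normcD _ _)) // lerD.
Qed.

Lemma dominatedZ B (c : C) f : dominated B f ->
  dominated (normc c * B) (fun x => c * f x).
Proof.
move=> [mf fB]; split.
  by apply: cmeasurableM => //; exact/ccontinuous_measurable/ccontinuous_cst.
by move=> x; rewrite normcM -mulrA ler_wpM2l // normc_ge0.
Qed.

(** A weak form of Fourier inversion at x0. With k = h/(x - x0), the integrand is up
to the factor i the derivative of e^{-i x0 xi} times the transform of k, and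
integration by parts makes that product O(1/|xi|). *)
Lemma cintegral_fourier_vanish f n : schwartz f ->
  (forall k, (n <= k)%N -> vanish (cderiven k f)) ->
  cintegral (fun xi => expi (- x0 * xi) * fourier (cderiven n f) xi) = 0.
Proof.
move=> sf f0.
pose h := cderiven n f; pose h1 := cderiven n.+1 f; pose h2 := cderiven n.+2 f.
have [z0 z1 z2] : [/\ vanish h, vanish h1 & vanish h2].
  by split; apply: f0 => //; rewrite ltnW.
have dh : is_cderive h h1 by exact: schwartz_is_cderive.
have dh1 : is_cderive h1 h2 by exact: schwartz_is_cderive.
pose k := divide_at h.
have dk := is_cderive_divide dh z0 z1; have dk1 := is_cderive_divide dh1 z1 z2.
have zk : vanish k by exact: vanish_divide.
pose k' x := divide_at h1 x - divide_at k x.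
have zk' : vanish k'.
  by move=> x xd; rewrite /k' !vanish_divide ?subr0.
have dkk := is_cderive_divide dk zk zk'.
have ck := is_cderive_continuous dk.
have ck' : ccontinuous k'.
  have c1 := is_cderive_continuous dk1; have c2 := is_cderive_continuous dkk.
  have -> : k' = (fun x => divide_at h1 x + (-1) * divide_at k x).
    by apply/funext => x; rewrite mulN1r.
  by apply: ccontinuousD => //; apply: ccontinuousM => //; exact: ccontinuous_cst.
have domh := schwartz_dominated n sf; have domh1 := schwartz_dominated n.+1 sf.
have domk := dominated_divide z0 ck domh.
have domk' : exists B, dominated B k'.
  have d1 := dominated_divide z1 (is_cderive_continuous dk1) domh1.
  have d2 := dominatedZ (-1) (dominated_divide zk (is_cderive_continuous dkk) domk).
  eexists; have := dominatedD d1 d2; congr dominated.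
  by apply/funext => x; rewrite mulN1r.
have cix : ccontinuous (fun x : R => x%:C * iC).
  apply: ccontinuousM; last exact: ccontinuous_cst.
  by apply: ccontinuous_real => x; exact: cvg_id.
have domxk : exists B, dominated B (fun x => x%:C * iC * k x).
  (* one extra power of x: the seminorms 1 and 3 replace 0 and 2 *)
  exists (delta^-1 * (seminorm 1 n f + seminorm 3 n f)); split.
    by apply/ccontinuous_measurable/ccontinuousM.
  move=> x; rewrite normcM (normcM _ iC) normc_real normc_iC mulr1.
  apply: (@le_trans _ _ (delta^-1 * (`|x| * normc (h x)))).
    by rewrite mulrCA ler_wpM2l // normc_divide.
  rewrite -mulrA ler_wpM2l ?invr_ge0 ?(ltW delta_gt0) //.
  apply: le_weight; apply: lerD; first by have := seminorm_ub 1 n x sf; rewrite expr1.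
  have := seminorm_ub 3 n x sf; apply: le_trans.
  by rewrite -[x ^+ 2]real_normK ?num_real // mulrA -exprSr.
have [B1 D1] := domk'; have [B2 D2] := domxk.
pose B := Num.max (Num.max B1 B2) (delta^-1 * (seminorm 0 n f + seminorm 2 n f)).
have {}D1 : dominated B k' by apply: dominatedW D1; rewrite !le_max lexx.
have {}D2 : dominated B (fun x => x%:C * iC * k x) by apply: dominatedW D2; rewrite !le_max lexx orbT.
have D0 : dominated B k by apply: dominatedW domk; rewrite !le_max lexx orbT.
have dF := is_cderive_fourier D0 D2.
have dG := is_cderiveM (is_cderive_expi (- x0)) dF.
pose G xi := expi (- x0 * xi) * fourier h xi.
have E : (fun xi => (- x0)%:C * iC * expi (- x0 * xi) * fourier k xi +
    expi (- x0 * xi) * fourier (fun x => x%:C * iC * k x) xi) = (fun xi => iC * G xi).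
  apply/funext => xi; rewrite /G.
  have -> : fourier (fun x => x%:C * iC * k x) xi = x0%:C * iC * fourier k xi + iC * fourier h xi.
    have ih := dominated_cintegrable (dominated_modulate xi domh).
    have ik := dominated_cintegrable (dominated_modulate xi D0).
    rewrite /fourier -!cintegralZ // -cintegralD; [|exact: cintegrableZ|exact: cintegrableZ].
    congr cintegral; apply/funext => x.
    have -> : h x = (x%:C - x0%:C) * k x.
      rewrite /k /divide_at mulrA -rmorphB -rmorphM /=.
      have [->|xx0] := eqVneq x x0; first by rewrite subrr mul0r mul0r z0 // subrr normr0.
      by rewrite divff ?subr_eq0 // mul1r.
    ring.
  have -> : (- x0)%:C = - x0%:C :> C by apply: complexP; rewrite /= ?oppr0.
  ring.
rewrite E in dG.
have cG : ccontinuous G.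
  by apply: ccontinuousM; [exact: ccontinuous_expi|exact: fourier_continuous domh].
have domG : exists B, dominated B G.
  pose c k := 2 * weight_mass * (seminorm 0 (n + k) f + seminorm 2 (n + k) f).
  exists (c 0%N + c 2%N); split; first exact: ccontinuous_measurable.
  move=> xi; rewrite normcM normc_expi mul1r; apply: le_weight; apply: lerD.
    by have := normc_fourier_schwartz 0 n xi sf; rewrite expr0 mul1r.
  by have := normc_fourier_schwartz 2 n xi sf; rewrite real_normK ?num_real.
have [B3 DG] := domG.
have iG := dominated_cintegrable DG.
have := @cintegral_derive_eq0 R _ _ (Num.max B3 (2 * weight_mass * B)) dG.
rewrite cintegralZ // => H.
have /eqP : iC * cintegral G = 0.
  apply: H.
  - by apply: ccontinuousM => //; exact: ccontinuous_cst.
  - move=> xi; rewrite normcM normc_iC mul1r; have [_ GB] := DG.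
    by apply: le_trans (GB xi) _; rewrite ler_wpM2r ?weight_ge0 // le_max lexx.
  - move=> xi; rewrite normcM normc_expi mul1r.
    have F := fourier_derive xi dk ck' D0 D1.
    have <- : normc (fourier k' xi) = `|xi| * normc (fourier k xi).
      by rewrite F normcM normcN normcM normc_real normc_iC mulr1.
    by apply: le_trans (normc_fourier_le xi D1) _; rewrite le_max lexx orbT.
by rewrite mulf_eq0 => /orP[/eqP/(congr1 (normc))|/eqP //]; rewrite normc_iC normc0 => /eqP; rewrite oner_eq0.
Qed.
End FourierVanish.

(** * The symbols at 1 *)

(** Turns the sums over all integers of the definitions into sums over a list
that contains the support. *)
Lemma fsumT_seq (V : nmodType) (s : seq int) (F : int -> V) : uniq s ->
  (forall k, k \notin s -> F k = 0) ->
  \sum_(k \in [set: int]) F k = \sum_(k <- s) F k.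
Proof.
move=> us Fs; rewrite (fsbigE s F us) //; last by move=> k _; exact: Fs.
by apply: eq_bigl => k; rewrite in_setT.
Qed.

Section SymbolAtOne.
Context {R : realType}.
Local Notation C := R[i].
Variables (m mt p : nat) (m_gt0 : (0 < m)%N) (mt_gt0 : (0 < mt)%N).

Lemma cdf_dual_symbol1 : cdf_dual_symbol m mt (1 : C) = 1.
Proof.
rewrite /cdf_dual_symbol expr1n invr1 mul1r -mulr2n -mulr_natl mulr1 divff ?pnatr_eq0 // expr1n mul1r.
have : (0 < (m + mt)./2)%N by rewrite half_gt0 (leq_add m_gt0 mt_gt0).
case: (_./2) => // K _; rewrite big_ord_recl /= addn0 bin0 expr0 mulr1 big1 ?addr0 // => i _.
by rewrite /bump /= (_ : 2 - 1 - 1 = 0 :> C) ?mul0r ?expr0n ?mulr0 //; ring.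
Qed.

Lemma cdf_dual_symbolN1 : cdf_dual_symbol m mt (-1 : C) = 0.
Proof. by rewrite /cdf_dual_symbol subrr mul0r expr0n gtn_eqF // mulr0 mul0r. Qed.

Variables (b : int -> R) (hb : cdf_wavelet_coef m mt b).

Lemma symbol_b1 : symbol b (1 : C) = 0.
Proof. by have [_ ->] := hb; rewrite ?normr1 // cdf_dual_symbolN1 rmorph0 mulr0. Qed.

Lemma symbol_bN1 : symbol b (-1 : C) = 1.
Proof.
have [_ ->] := hb; last by rewrite normrN1.
by rewrite opprK mul1r cdf_dual_symbol1 rmorph1.
Qed.

(** The second term carries the factor b(1) = 0. *)
Lemma quark_T1 : quark_T m p b 1 = mx_symbol (@quark_mask R m p) 1.
Proof. by rewrite /quark_T symbol_b1 symbol_bN1 scale1r scale0r subr0. Qed.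

Let supp : seq int := [seq n%:Z - (m./2)%:Z | n <- iota 0 m.+1].

Let supp_uniq : uniq supp.
Proof. by rewrite map_inj_uniq ?iota_uniq // => i j /addIr[]. Qed.

Let mask_out k : k \notin supp -> @spline_mask R m k = 0.
Proof.
move=> ks; rewrite /spline_mask; case: ifP => // /andP[h1 h2].
case/negP: ks; apply/mapP; exists (absz (k + (m./2)%:Z)).
  rewrite mem_iota add0n /=; have := uphalf_half m; have := odd_double_half m; lia.
lia.
Qed.

Lemma sum_spline_mask : 2^-1 * \sum_(k <- supp) @spline_mask R m k = 1.
Proof.
rewrite big_map -[iota 0 m.+1]/(index_iota 0 m.+1) big_mkord.
have E (i : 'I_m.+1) : @spline_mask R m (i%:Z - (m./2)%:Z) = 2 ^ (1 - m%:Z) * 'C(m, i)%:R.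
  rewrite /spline_mask subrK absz_nat ifT //.
  have := uphalf_half m; have := odd_double_half m; have := ltn_ord i; lia.
rewrite (eq_bigr _ (fun i _ => E i)) -mulr_sumr -natr_sum.
have -> : (\sum_(i < m.+1) 'C(m, i) = 2 ^ m)%N.
  by rewrite -[2%N]/(1 + 1)%N expnDn; apply: eq_bigr => i _; rewrite !exp1n !muln1.
rewrite natrX expfzDr ?pnatr_eq0 // expr1z -exprnN mulrA mulrA mulVf ?pnatr_eq0 // mul1r.
by rewrite mulVf // expf_neq0 // pnatr_eq0.
Qed.

Lemma quark_symbol_entry (i j : 'I_p.+1) :
  mx_symbol (@quark_mask R m p) 1 i j = 2^-1 * \sum_(k <- supp) @quark_mask R m p k i j.
Proof.
rewrite /mx_symbol (@fsumT_seq _ supp) //; last first.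
  by move=> k /mask_out k0; apply/matrixP => a c; rewrite !mxE k0 !(mulr0, mul0r).
by rewrite mxE summxE; congr (_ * _); apply: eq_bigr => k _; rewrite mxE exp1rz mul1r.
Qed.

Lemma quark_symbol_trig : is_trig_mx (mx_symbol (@quark_mask R m p) 1).
Proof.
apply/is_trig_mxP => i j ij; rewrite quark_symbol_entry big1 ?mulr0 // => k _.
by rewrite mxE bin_small // mulr0 mul0r.
Qed.

Lemma quark_symbol_diag i : mx_symbol (@quark_mask R m p) 1 i i = 2 ^- i.
Proof.
rewrite quark_symbol_entry (eq_bigr (fun k => 2 ^- i * @spline_mask R m k)); last first.
  by move=> k _; rewrite mxE subrr expr0z subnn expr0 binn !mulr1.
by rewrite -mulr_sumr mulrCA sum_spline_mask mulr1.
Qed.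

(** Forward substitution in the equation L X = 1, by strong induction on the row. *)
Lemma trig_inverse (n : nat) (L X : 'M[C]_n) : is_trig_mx L ->
  (forall i, L i i != 0) -> L *m X = 1%:M ->
  (forall i j : 'I_n, (i < j)%N -> X i j = 0) /\ (forall i, X i i = (L i i)^-1).
Proof.
move=> /is_trig_mxP Lt Ld LX.
have E (i j : 'I_n) : (i <= j)%N -> (forall k : 'I_n, (k < i)%N -> X k j = 0) ->
    L i i * X i j = (i == j)%:R.
  move=> ij Xk; have := congr1 (fun A : 'M[C]_n => A i j) LX; rewrite !mxE => <-.
  rewrite (bigD1 i) //= big1 ?addr0 // => k ki.
  have [ik|ik] := ltnP i k; first by rewrite Lt ?mul0r.
  by rewrite Xk ?mulr0 // ltn_neqAle (inj_eq val_inj) ki ik.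
have X0 (i j : 'I_n) : (i < j)%N -> X i j = 0.
  have [q] := ubnP i; elim: q i => // q IH i iq ij.
  have := E i j (ltnW ij); rewrite (_ : i == j = false) ?mulr0n; last first.
    by apply/eqP => e; rewrite e ltnn in ij.
  move=> h; apply: (mulfI (Ld i)); rewrite mulr0 h // => k ki.
  by apply: IH; [exact: leq_trans ki iq|exact: ltn_trans ij].
split=> // i; apply: (mulfI (Ld i)); rewrite divff // E // ?eqxx //.
by move=> k; exact: X0.
Qed.

Variables (At : int -> 'M[C]_p.+1) (hAt : dual_refinement_matrices m b At).

(** The conjugate transpose of the dual symbol at 1 is the inverse of the quark
symbol at 1, which is triangular with known diagonal. *)
Lemma dual_symbol_at1 :
  (forall i j : 'I_p.+1, (j < i)%N -> mx_symbol At 1 i j = 0) /\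
  (forall i : 'I_p.+1, mx_symbol At 1 i i = 2 ^+ i).
Proof.
have [_ /(_ 1)] := hAt; rewrite normr1 => /(_ erefl).
rewrite symbol_bN1 scale1r quark_T1; set L := mx_symbol (quark_mask _ _) 1 => E.
have Ld i : L i i != 0 by rewrite quark_symbol_diag invr_eq0 expf_neq0 // pnatr_eq0.
have Lu : L \in unitmx.
  by rewrite unitmxE (det_trig quark_symbol_trig) unitfE; apply/prodf_neq0.
have [X0 Xd] := trig_inverse quark_symbol_trig Ld (mulmxV Lu).
have e i j : (mx_symbol At 1 i j) = conjc (invmx L j i).
  by rewrite -E !mxE conjcK.
split=> [i j ji|i]; rewrite e; first by rewrite X0 // conjc0.
by rewrite Xd quark_symbol_diag invrK rmorphXn rmorph_nat.
Qed.
End SymbolAtOne.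

(** * Weighted matrix norms *)

Section Expi.
Context {R : realType}.
Local Notation C := R[i].

Lemma expi_exprz (t : R) (k : int) : expi t ^ k = expi (k%:~R * t).
Proof.
have E n : expi t ^+ n = expi (n%:R * t).
  elim: n => [|n IH]; first by rewrite expr0 mul0r expi0.
  by rewrite exprS IH -expiD -[in RHS]natr1 mulrDl mul1r addrC.
case: k => n; first by rewrite -exprnP E.
rewrite NegzE -exprnN E; set a := n.+1%:R * t.
have -> : (- n.+1%:Z)%:~R * t = - a by rewrite mulrNz mulNr.
have a0 : expi a != 0.
  by apply/eqP => /(congr1 normc); rewrite normc_expi normc0 => /eqP; rewrite oner_eq0.
by apply: (mulfI a0); rewrite divff // -expiD subrr expi0.
Qed.

Lemma normr_sub_derive_le (f f' : R -> R) (t : R) :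
  (forall x : R, is_derive x 1 f (f' x)) -> (forall x, `|f' x| <= 1) ->
  `|f t - f 0| <= `|t|.
Proof.
move=> df f'1.
have cf : continuous f.
  move=> x; apply: differentiable_continuous; apply/derivable1_diffP.
  by have dfx := df x; exact: ex_derive.
have [t0|t0] := leP 0 t.
  have [c _ ->] := @MVT_segment R f f' 0 t t0 (fun x _ => df x) (continuous_subspaceT cf).
  by rewrite subr0 normrM ler_piMl.
have [c _] := @MVT_segment R f f' t 0 (ltW t0) (fun x _ => df x) (continuous_subspaceT cf).
by rewrite distrC => ->; rewrite sub0r normrM normrN ler_piMl.
Qed.

Lemma normc_expi_sub1 (t : R) : normc (expi t - 1) <= 2 * `|t|.
Proof.
rewrite (le_trans (normc_le_ReIm _)) // mulr_natl mulr2n; apply: lerD.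
  rewrite ReD ReN /= -[X in _ - X]cos0.
  apply: (@normr_sub_derive_le _ (fun x => - sin x)) => x.
  by rewrite normrN ler_norml sin_geN1 sin_le1.
rewrite ImD ImN /= -[X in _ - X]sin0.
apply: (@normr_sub_derive_le _ (@cos R)) => x.
by rewrite ler_norml cos_geN1 cos_le1.
Qed.
End Expi.

Section WeightedNorm.
Context {R : realType}.
Local Notation C := R[i].
Variables (n : nat) (w : 'I_n -> R) (w_gt0 : forall i, 0 < w i).

(** A bound on the operator norm for the weighted supremum norm max_i |x_i| / w_i. *)
Definition wnorm_le (c : R) (A : 'M[C]_n) :=
  forall i, \sum_j normc (A i j) * w j <= c * w i.

Lemma wnorm_leD c d A B : wnorm_le c A -> wnorm_le d B -> wnorm_le (c + d) (A + B).
Proof.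
move=> Ac Bd i; rewrite mulrDl; apply: le_trans (lerD (Ac i) (Bd i)).
rewrite -big_split /=; apply: ler_sum => j _; rewrite mxE -mulrDl.
by rewrite ler_pM2r // le_normcD.
Qed.

Lemma wnorm_leM c d A B : 0 <= d -> wnorm_le c A -> wnorm_le d B -> wnorm_le (c * d) (A *m B).
Proof.
move=> d0 Ac Bd i; rewrite mulrAC [c * _]mulrC.
rewrite [X in X * d]mulrC.
apply: le_trans (_ : (\sum_k normc (A i k) * w k) * d <= _); last first.
  by rewrite ler_wpM2r.
rewrite mulr_suml.
apply: le_trans (_ : \sum_j \sum_k normc (A i k) * (normc (B k j) * w j) <= _).
  apply: ler_sum => j _; rewrite mxE.
  apply: le_trans (_ : (\sum_k normc (A i k * B k j)) * w j <= _).
    by rewrite ler_pM2r // ler_normc_sum.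
  by rewrite mulr_suml; apply: ler_sum => k _; rewrite normcM mulrA.
rewrite exchange_big; apply: ler_sum => k _; rewrite -mulr_sumr -mulrA.
by rewrite ler_wpM2l ?normc_ge0 // mulrC Bd.
Qed.

Lemma wnorm_leW c d A : c <= d -> wnorm_le c A -> wnorm_le d A.
Proof. by move=> cd Ac i; apply: le_trans (Ac i) _; rewrite ler_pM2r. Qed.

Lemma wnorm_le1 : wnorm_le 1 1%:M.
Proof.
move=> i; rewrite (bigD1 i) //= big1 ?addr0; last first.
  by move=> j ji; rewrite mxE eq_sym (negbTE ji) normc0 mul0r.
by rewrite mxE eqxx normc1.
Qed.

Lemma wnorm_le_mul c A (x : 'cV[C]_n) (V : R) : 0 <= V -> wnorm_le c A ->
  (forall j, normc (x j 0) <= V * w j) ->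
  forall i, normc ((A *m x) i 0) <= c * V * w i.
Proof.
move=> V0 Ac xV i; rewrite mxE (le_trans (ler_normc_sum _ _ _)) //.
rewrite mulrAC mulrC; apply: le_trans (ler_wpM2l V0 (Ac i)); rewrite mulr_sumr.
apply: ler_sum => j _; rewrite normcM mulrCA; apply: ler_wpM2l => //; exact: normc_ge0.
Qed.

Lemma wnorm_le_entries (l : R) : 0 <= l -> exists2 K : R, 0 <= K &
  forall (A : 'M[C]_n) (c : R), 0 <= c ->
    (forall i j, normc (A i j) <= l * c) -> wnorm_le (K * c) A.
Proof.
move=> l0; pose T := \sum_j w j.
have T0 : 0 <= T by apply: sumr_ge0 => j _; exact: ltW.
have lT0 i : 0 <= l * T / w i by rewrite !mulr_ge0 // invr_ge0 ltW.
exists (\sum_i l * T / w i); first exact: sumr_ge0.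
move=> A c c0 Al i; apply: le_trans (_ : l * c * T <= _).
  by rewrite mulr_sumr; apply: ler_sum => j _; rewrite ler_pM2r.
have -> : l * c * T = l * T / w i * (c * w i).
  by field; rewrite gt_eqF.
rewrite -[leRHS]mulrA; apply: ler_wpM2r; first by rewrite mulr_ge0 // ltW.
by rewrite (bigD1 i) //= lerDl sumr_ge0.
Qed.
End WeightedNorm.

(** With geometric weights e^i the entries above the diagonal are multiplied by
powers of the small number e, so that they fit in the room left by a diagonal
entry at most 1/2; the last row has only its diagonal entry. *)
Lemma triangular_weight (R : realType) (p : nat) (A : 'M[R[i]]_p.+1) :
  (forall i j : 'I_p.+1, (j < i)%N -> A i j = 0) ->
  (forall i : 'I_p.+1, (i < p)%N -> normc (A i i) <= 2^-1) ->
  normc (A ord_max ord_max) <= 1 ->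
  exists2 w : 'I_p.+1 -> R, (forall i, 0 < w i) & wnorm_le w 1 A.
Proof.
move=> A0 Ad Ap.
pose S : R := 1 + \sum_i \sum_j normc (A i j).
have T0 : 0 <= \sum_i \sum_j normc (A i j).
  by apply: sumr_ge0 => i _; apply: sumr_ge0 => j _; exact: normc_ge0.
have S1 : 1 <= S by rewrite lerDl.
have S0 : 0 < S := lt_le_trans ltr01 S1.
(* e S <= 1/2, where S bounds the sum of all entries *)
pose e : R := (2 * S)^-1.
have e0 : 0 < e by rewrite invr_gt0 mulr_gt0.
have e1 : e <= 1 by rewrite invf_le1 ?mulr_gt0 // mulr_ege1 // ler1n.
exists (fun i => e ^+ i); first by move=> i; exact: exprn_gt0.
move=> i; rewrite mul1r (bigD1 i) //=.
have [ip|ip] := ltnP i p; last first.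
  have ei : i = ord_max by apply/val_inj/eqP; rewrite eqn_leq ip -ltnS ltn_ord.
  rewrite big1 ?addr0; first by rewrite ei ler_piMl // exprn_ge0 // ltW.
  move=> j ji; rewrite A0 ?normc0 ?mul0r //.
  by rewrite ei /= ltn_neqAle -ltnS ltn_ord andbT; apply: contra ji => /eqP jp; rewrite ei; apply/eqP/val_inj.
rewrite [leRHS](_ : _ = 2^-1 * e ^+ i + 2^-1 * e ^+ i); last by field.
apply: lerD; first by rewrite ler_wpM2r ?exprn_ge0 ?(ltW e0) // Ad.
apply: le_trans (_ : (\sum_(j | j != i) normc (A i j)) * (e * e ^+ i) <= _).
  rewrite mulr_suml; apply: ler_sum => j ji.
  have [ij|ij] := ltnP j i; first by rewrite A0 // normc0 !mul0r.
  have {}ij : (i < j)%N by rewrite ltn_neqAle eq_sym (inj_eq val_inj) ji.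
  rewrite ler_wpM2l ?normc_ge0 // -exprS.
  by apply: ler_wiXn2l => //; exact: ltW.
rewrite mulrA ler_pM2r ?exprn_gt0 //.
rewrite /e ler_pdivrMr ?mulr_gt0 // mulrA mulVf ?pnatr_eq0 // mul1r.
apply: le_trans (_ : \sum_i \sum_j normc (A i j) <= _); last by rewrite lerDr.
rewrite [leRHS](bigD1 i) //= [X in X + _](bigD1 i) //=.
rewrite -addrA addrCA lerDl addr_ge0 ?normc_ge0 //.
by apply: sumr_ge0 => a _; apply: sumr_ge0 => c _; exact: normc_ge0.
Qed.

Lemma cvgn_geometric_increments (R : realType) (u : nat -> R) (K : R) :
  (forall n, `|u n.+1 - u n| <= K * 2^-1 ^+ n) -> cvgn u.
Proof.
move=> uK.
have K0 : 0 <= K by have := uK 0%N; rewrite expr0 mulr1; apply: le_trans.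
have cs : cvgn (series (telescope u)).
  apply: (@normed_cvg R R^o).
  apply: (@series_le_cvg _ (fun n => `|telescope u n|) (fun n => K * 2^-1 ^+ n)).
  - by move=> n; exact: normr_ge0.
  - by move=> n; rewrite mulr_ge0 // exprn_ge0 // invr_ge0.
  - by move=> n; exact: uK.
  - by apply: is_cvg_geometric_series; rewrite ger0_norm // invf_lt1 // ltr1n.
rewrite (_ : u = fun n => u 0%N + series (telescope u) n).
  by apply: is_cvgD => //; exact: is_cvg_cst.
by apply/funext => n; exact: eq_sum_telescope.
Qed.

(** * The infinite matrix product *)

Section InfiniteProduct.
Context {R : realType}.
Local Notation C := R[i].
Variables (p : nat) (M : R -> 'M[C]_p.+1) (w : 'I_p.+1 -> R) (L : R) (d : nat).
Variable v : 'cV[C]_p.+1.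
Hypothesis w_gt0 : forall i, 0 < w i.
Hypothesis L_ge0 : 0 <= L.
Hypothesis M0_le : wnorm_le w 1 (M 0).
Hypothesis M_lipschitz : forall t, wnorm_le w (L * `|t|) (M t - M 0).
Hypothesis M_le : forall t, wnorm_le w (2 ^+ d) (M t).
Hypothesis M0v : M 0 *m v = v.

Definition partial_product (n : nat) (xi : R) : 'M[C]_p.+1 :=
  \prod_(1 <= j < n.+1) M (2 ^- j * xi).

Lemma partial_product0 xi : partial_product 0 xi = 1%:M.
Proof. by rewrite /partial_product big_geq. Qed.

Lemma partial_productSl n xi :
  partial_product n.+1 xi = M (xi / 2) *m partial_product n (xi / 2).
Proof.
rewrite /partial_product big_nat_recl // expr1 [_ * xi]mulrC; congr (_ * _).
rewrite (big_addn 0 _ 1) subn1 /= [in RHS](big_addn 0 _ 1) subn1 /=.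
apply: eq_bigr => j _; rewrite addn1 [in LHS]exprS; congr M.
by rewrite invfM [2^-1 * _]mulrC -mulrA [2^-1 * _]mulrC.
Qed.

Lemma partial_productSr n xi :
  partial_product n.+1 xi = partial_product n xi *m M (2 ^- n.+1 * xi).
Proof. by rewrite /partial_product big_nat_recr. Qed.

Lemma M_le_exp t : wnorm_le w (expR (L * `|t|)) (M t).
Proof.
have -> : M t = M 0 + (M t - M 0) by rewrite addrC subrK.
apply: (wnorm_leW w_gt0 _ (wnorm_leD w_gt0 M0_le (M_lipschitz t))).
exact: expR_ge1Dx.
Qed.

Lemma normr_half (xi : R) : `|xi / 2| = `|xi| / 2.
Proof. by rewrite normrM normfV normr_nat. Qed.

Lemma partial_product_le_exp n xi :
  wnorm_le w (expR (L * `|xi|)) (partial_product n xi).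
Proof.
elim: n xi => [|n IH] xi.
  rewrite partial_product0; apply: (wnorm_leW w_gt0 _ (wnorm_le1 w)).
  by rewrite -expR0 ler_expR mulr_ge0.
rewrite partial_productSl.
rewrite (_ : expR _ = expR (L * `|xi / 2|) * expR (L * `|xi / 2|)); last first.
  by rewrite -expRD normr_half; congr expR; field.
by apply: wnorm_leM; [exact: w_gt0|exact: expR_ge0|exact: M_le_exp|exact: IH].
Qed.

(** For |xi| <= 2 the exponential bound is a constant. For larger xi, peeling off the
first factor costs 2^d and halves xi, so that |xi|^d absorbs it. *)
Lemma partial_product_le_poly n xi :
  wnorm_le w (expR (L * 2) * Num.max 1 `|xi| ^+ d) (partial_product n xi).
Proof.
have max1 (t : R) : 1 <= Num.max 1 t ^+ d by rewrite exprn_ege1 // le_max lexx.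
elim: n xi => [|n IH] xi.
  rewrite partial_product0; apply: (wnorm_leW w_gt0 _ (wnorm_le1 w)).
  by rewrite mulr_ege1 // -expR0 ler_expR mulr_ge0.
have [xi2|xi2] := leP `|xi| 2.
  apply: (wnorm_leW w_gt0 _ (partial_product_le_exp _ xi)).
  apply: le_trans (_ : expR (L * 2) <= _); first by rewrite ler_expR ler_wpM2l.
  by rewrite ler_peMr // expR_ge0.
rewrite partial_productSl.
have := wnorm_leM w_gt0 _ (M_le (xi / 2)) (IH (xi / 2)).
rewrite normr_half => h.
have x1 : 1 <= `|xi| / 2 by rewrite ler_pdivlMr // mul1r ltW.
have x1' : 1 <= `|xi| by apply: le_trans (ltW xi2); rewrite ler1n.
move: h; rewrite (max_idPr x1) (max_idPr x1') mulrCA -exprMn [2 * _]mulrC divfK // => h.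
by apply: h; rewrite mulr_ge0 ?expR_ge0 // exprn_ge0 // (le_trans ler01).
Qed.

Let V := \sum_j normc (v j 0) / w j.

Lemma entry_le_weight j : normc (v j 0) <= V * w j.
Proof.
rewrite -ler_pdivrMr // /V (bigD1 j) //= lerDl sumr_ge0 // => i _.
by rewrite mulr_ge0 ?normc_ge0 // invr_ge0 ltW.
Qed.

Lemma V_ge0 : 0 <= V.
Proof. by apply: sumr_ge0 => i _; rewrite mulr_ge0 ?normc_ge0 // invr_ge0 ltW. Qed.

(** Since M 0 fixes v, passing from n to n + 1 factors replaces v by
v + (M (xi / 2^(n + 1)) - M 0) v. *)
Lemma partial_product_increment n xi i :
  normc ((partial_product n.+1 xi *m v) i 0 - (partial_product n xi *m v) i 0) <=
  (expR (L * `|xi|) * (L * `|xi| * V) * w i) * 2^-1 ^+ n.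
Proof.
have -> : (partial_product n.+1 xi *m v) i 0 - (partial_product n xi *m v) i 0 =
    (partial_product n xi *m ((M (2 ^- n.+1 * xi) - M 0) *m v)) i 0.
  by rewrite mulmxBl M0v mulmxBr mulmxA -partial_productSr !mxE.
have y := wnorm_le_mul V_ge0 (M_lipschitz (2 ^- n.+1 * xi)) entry_le_weight.
have LV : 0 <= L * `|2 ^- n.+1 * xi| * V by rewrite !mulr_ge0 // V_ge0.
have := wnorm_le_mul LV (partial_product_le_exp n xi) y i.
move=> h; apply: le_trans h _.
have -> : `|2 ^- n.+1 * xi| = `|xi| * (2^-1 ^+ n * 2^-1).
  by rewrite normrM -exprVn -exprSr ger0_norm ?exprn_ge0 ?invr_ge0 // mulrC.
have e0 := expR_ge0 (L * `|xi|).
rewrite (_ : _ * w i = (expR (L * `|xi|) * (L * `|xi| * V) * w i) * 2^-1 ^+ n * 2^-1); last by ring.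
apply: ler_piMr; last by rewrite invf_le1 // ler1n.
by rewrite !mulr_ge0 ?V_ge0 ?exprn_ge0 ?invr_ge0 // ltW.
Qed.

Lemma partial_product_cvg xi (i : 'I_p.+1) :
  exists l, ccvg (fun n => (partial_product n xi *m v) i 0) l.
Proof.
pose u n := (partial_product n xi *m v) i 0.
pose K := expR (L * `|xi|) * (L * `|xi| * V) * w i.
have uK n : normc (u n.+1 - u n) <= K * 2^-1 ^+ n by exact: partial_product_increment.
have cr : cvgn (fun n => complex.Re (u n)).
  apply: (@cvgn_geometric_increments _ _ K) => n.
  by rewrite -ReN -ReD; exact: le_trans (Re_le_normc _) (uK n).
have ci : cvgn (fun n => complex.Im (u n)).
  apply: (@cvgn_geometric_increments _ _ K) => n.
  by rewrite -ImN -ImD; exact: le_trans (Im_le_normc _) (uK n).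
by exists (limn (fun n => complex.Re (u n)) +i* limn (fun n => complex.Im (u n))).
Qed.

Lemma partial_product_growth : exists2 B : R, 0 <= B &
  forall n xi i, normc ((partial_product n xi *m v) i 0) <= B * Num.max 1 `|xi| ^+ d.
Proof.
exists (expR (L * 2) * V * \sum_i w i).
  by rewrite !mulr_ge0 ?expR_ge0 ?V_ge0 // sumr_ge0 // => i _; exact: ltW.
move=> n xi i.
have := wnorm_le_mul V_ge0 (partial_product_le_poly n xi) entry_le_weight i.
move=> h; apply: le_trans h _.
rewrite mulrAC -[leRHS]mulrA [leRHS]mulrA mulrAC.
have m0 : 0 <= Num.max 1 `|xi| ^+ d by rewrite exprn_ge0 // le_max ler01.
rewrite [leRHS](_ : _ = expR (L * 2) * V * Num.max 1 `|xi| ^+ d * \sum_i w i); last by ring.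
rewrite [leLHS](_ : _ = expR (L * 2) * V * Num.max 1 `|xi| ^+ d * w i); last by ring.
apply: ler_wpM2l; first by rewrite !mulr_ge0 ?expR_ge0 ?V_ge0.
by rewrite (bigD1 i) //= lerDl sumr_ge0 // => j _; exact: ltW.
Qed.

Variable g : R -> 'cV[C]_p.+1.
Hypothesis g_lim : forall xi i, ccvg (fun n => (partial_product n xi *m v) i 0) (g xi i 0).

(** The limit of [partial_productSl]. *)
Lemma infinite_product_refine (xi : R) : g xi = M (xi / 2) *m g (xi / 2).
Proof.
apply/matrixP => i j; rewrite ord1 {j}.
apply: (@ccvg_unique _ (fun n => (partial_product n.+1 xi *m v) i 0)).
  by have [h1 h2] := g_lim xi i; split; [rewrite (cvg_shiftS (fun n => complex.Re ((partial_product n xi *m v) i 0)))|rewrite (cvg_shiftS (fun n => complex.Im ((partial_product n xi *m v) i 0)))].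
have -> : (fun n => (partial_product n.+1 xi *m v) i 0) =
   (fun n => \sum_j M (xi / 2) i j * (partial_product n (xi / 2) *m v) j 0).
  by apply/funext => n; rewrite partial_productSl -mulmxA mxE.
rewrite mxE; apply: ccvg_sum => j; apply: ccvgM; [exact: ccvg_cst|exact: g_lim].
Qed.
End InfiniteProduct.

(** * Trigonometric polynomials and derivatives of Schwartz functions *)

Section TrigonometricPolynomials.
Context {R : realType}.
Local Notation C := R[i].
Implicit Types P Q : R -> C.

(** Finite combinations of the characters e^{-i x xi} with |x| <= N: these are the
transforms of finite combinations of point masses in [-N, N]. The list records
the coefficients and the points x. *)
Definition trigpoly (N : R) P := exists2 s : seq (C * R),
  all (fun t => `|t.2| <= N) s &
  forall xi, P xi = \sum_(t <- s) t.1 * expi (- t.2 * xi).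

Lemma trigpoly_cst N (c : C) : 0 <= N -> trigpoly N (fun=> c).
Proof.
move=> N0; exists [:: (c, 0)]; first by rewrite /= normr0 N0.
by move=> xi; rewrite big_seq1 /= oppr0 mul0r expi0 mulr1.
Qed.

Lemma trigpolyD N P Q : trigpoly N P -> trigpoly N Q ->
  trigpoly N (fun xi => P xi + Q xi).
Proof.
move=> [s sN Ps] [t tN Qt]; exists (s ++ t); first by rewrite all_cat sN.
by move=> xi; rewrite big_cat Ps Qt.
Qed.

Lemma trigpoly_sum N (I : Type) (r : seq I) (F : I -> R -> C) : 0 <= N ->
  (forall i, trigpoly N (F i)) -> trigpoly N (fun xi => \sum_(i <- r) F i xi).
Proof.
move=> N0 FN; elim: r => [|i r IH].
  by under eq_fun do rewrite big_nil; exact: trigpoly_cst.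
by under eq_fun do rewrite big_cons; exact: trigpolyD.
Qed.

Lemma trigpolyM N1 N2 P Q : trigpoly N1 P -> trigpoly N2 Q ->
  trigpoly (N1 + N2) (fun xi => P xi * Q xi).
Proof.
move=> [s sN Ps] [t tN Qt].
exists [seq (a.1 * b.1, a.2 + b.2) | a <- s, b <- t].
  apply/allP => _ /allpairsP[[a b] /= [/(allP sN) aN /(allP tN) bN ->]] /=.
  by rewrite (le_trans (ler_normD _ _)) // lerD.
move=> xi; rewrite Ps Qt big_allpairs_dep mulr_suml; apply: eq_bigr => a _.
rewrite mulr_sumr; apply: eq_bigr => b _ /=.
by rewrite opprD mulrDl expiD mulrACA.
Qed.

Lemma trigpoly_half N P : trigpoly N P -> trigpoly (N / 2) (fun xi => P (xi / 2)).
Proof.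
move=> [s sN Ps]; exists [seq (t.1, t.2 / 2) | t <- s].
  apply/allP => _ /mapP[t /(allP sN) /= tN ->] /=.
  by rewrite normrM normfV normr_nat ler_pM2r ?invr_gt0.
move=> xi; rewrite Ps big_map; apply: eq_bigr => t _ /=.
by congr (_ * expi _); ring.
Qed.

Lemma trigpoly_continuous N P : trigpoly N P -> ccontinuous P.
Proof.
move=> [s _ Ps]; rewrite (_ : P = fun xi => \sum_(t <- s) t.1 * expi (- t.2 * xi)); last exact/funext.
elim: s {Ps} => [|t s IH].
  by under eq_fun do rewrite big_nil; exact: ccontinuous_cst.
under eq_fun do rewrite big_cons; apply: ccontinuousD => //.
by apply: ccontinuousM; [exact: ccontinuous_cst|exact: ccontinuous_expi].
Qed.

Lemma trigpoly_pairing_eq0 N P B (F : R -> C) : trigpoly N P -> dominated B F ->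
  (forall x0, `|x0| <= N -> cintegral (fun xi => expi (- x0 * xi) * F xi) = 0) ->
  cintegral (fun xi => P xi * F xi) = 0.
Proof.
move=> [s sN Ps] dF F0.
have iF (t : R) : cintegrable (fun xi => expi (t * xi) * F xi).
  by under eq_fun do rewrite mulrC; exact: dominated_cintegrable (dominated_modulate t dF).
rewrite (_ : (fun xi => _) = fun xi => \sum_(t <- s) t.1 * (expi (- t.2 * xi) * F xi)); last first.
  by apply/funext => xi; rewrite Ps mulr_suml; apply: eq_bigr => t _; rewrite mulrA.
rewrite cintegral_sum; last by move=> t; exact: cintegrableZ.
rewrite big_seq big1 // => t /(allP sN) tN.
by rewrite cintegralZ // F0 // mulr0.
Qed.
End TrigonometricPolynomials.

Section SchwartzDerivatives.
Context {R : realType}.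
Local Notation C := R[i].
Implicit Types f h : R -> C.

Lemma cderiven0 f : cderiven 0 f = f.
Proof. by apply/funext => x; exact: complexP. Qed.

Lemma cderivenS_eq f n f' : is_cderive (cderiven n f) f' -> cderiven n.+1 f = f'.
Proof.
move=> df; apply/funext => x; have [d1 d2] := df x.
by apply: complexP; rewrite /= derive1E; exact: derive_val.
Qed.

Lemma is_cderiveD f f' h h' : is_cderive f f' -> is_cderive h h' ->
  is_cderive (fun x => f x + h x) (fun x => f' x + h' x).
Proof.
move=> df dh x; have [? ?] := df x; have [? ?] := dh x; split.
  rewrite (_ : _ \o _ = (@complex.Re R \o f) + (@complex.Re R \o h)); last first.
    by apply/funext=> t /=; rewrite ReD.
  by rewrite ReD; exact: is_deriveD.
rewrite (_ : _ \o _ = (@complex.Im R \o f) + (@complex.Im R \o h)); last first.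
  by apply/funext=> t /=; rewrite ImD.
by rewrite ImD; exact: is_deriveD.
Qed.

Lemma cderiven_linear (c : C) f h n : schwartz f -> schwartz h ->
  cderiven n (fun x => c * f x + h x) = (fun x => c * cderiven n f x + cderiven n h x).
Proof.
move=> sf sh; elim: n => [|n IH]; first by rewrite !cderiven0.
apply: cderivenS_eq; rewrite IH; apply: is_cderiveD; last exact: schwartz_is_cderive.
by apply: is_cderiveZ; exact: schwartz_is_cderive.
Qed.

Lemma is_cderive_affine (c : R) f f' : is_cderive f f' ->
  is_cderive (fun y => f ((y + c) / 2)) (fun y => 2^-1 * f' ((y + c) / 2)).
Proof.
move=> df x.
have da : is_derive x 1 (fun y : R => (y + c) / 2) 2^-1.
  by apply: is_derive_eq; rewrite /GRing.scale /=; ring.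
have [d1 d2] := df ((x + c) / 2).
have e : 2^-1 = (2^-1 : R)%:C :> C by rewrite rmorphV ?unitfE ?pnatr_eq0 // rmorph_nat.
rewrite e; split.
  have h := @is_derive1_comp _ _ (fun y : R => (y + c) / 2) x _ _ d1 da.
  by rewrite ReM /= mul0r subr0 mulrC; exact: h.
have h := @is_derive1_comp _ _ (fun y : R => (y + c) / 2) x _ _ d2 da.
by rewrite ImM /= mul0r addr0 mulrC; exact: h.
Qed.

Lemma cderiven_affine (c : R) f n : schwartz f ->
  cderiven n (fun y => f ((y + c) / 2)) = (fun y => 2 ^- n * cderiven n f ((y + c) / 2)).
Proof.
move=> sf; elim: n => [|n IH].
  by rewrite !cderiven0; apply/funext => y; rewrite expr0 invr1 mul1r.
apply: cderivenS_eq; rewrite IH.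
have := is_cderiveZ (2 ^- n) (is_cderive_affine c (schwartz_is_cderive n sf)).
by congr is_cderive; apply/funext => y; rewrite mulrA exprSr invfM.
Qed.

Lemma cderiven_vanish (x0 delta : R) f n : vanishes_near x0 delta f ->
  vanishes_near x0 delta (cderiven n f).
Proof.
move=> f0; have aux (h : R -> R) : (forall x, `|x - x0| < delta -> h x = 0) ->
    forall x, `|x - x0| < delta -> derive1n n h x = 0.
  move=> h0; elim: n => [//|n IH] x xd; rewrite derive1nS derive1E.
  rewrite -(@near_eq_derive _ _ _ (cst 0)) ?derive_cst //.
  by apply: filterS (near_dist_lt xd) => t /IH ->.
by move=> x xd; apply: complexP; rewrite /= aux // => y yd /=; rewrite f0.
Qed.

Lemma seminorm_le_sum f k n N : schwartz f -> (k <= N)%N -> (n <= N)%N ->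
  seminorm k n f <= \sum_(k < N.+1) \sum_(n < N.+1) seminorm k n f.
Proof.
move=> sf; rewrite -ltnS => kN; rewrite -ltnS => nN.
rewrite (bigD1 (Ordinal kN)) //= (bigD1 (Ordinal nN)) //= -addrA lerDl.
by rewrite addr_ge0 ?sumr_ge0 // => i _; rewrite ?sumr_ge0 // => *; exact: seminorm_ge0.
Qed.
End SchwartzDerivatives.

(** * Pairing with functions of polynomial growth *)

Section Pairing.
Context {R : realType}.
Local Notation C := R[i].
Local Notation W := (@weight_mass R).
Implicit Types f g phi : R -> C.

Definition poly_growth (B : R) (d : nat) g := [/\ 0 <= B, cmeasurable g &
  forall xi, normc (g xi) <= B * Num.max 1 `|xi| ^+ d].

(** The exponents up to d + 2 are those needed to pair with a function of growth d
and to dominate the product by the weight. *)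
Definition decay (S : R) (d : nat) phi := cmeasurable phi /\
  forall k xi, (k <= d.+2)%N -> `|xi| ^+ k * normc (phi xi) <= S.

(** As max(1, |x|)^d <= 1 + |x|^d, the modulus times 1 + x^2 is at most B times four
terms of the form |x|^k |phi x|, each at most S. *)
Lemma pairing_dominated B d g S phi : poly_growth B d g -> decay S d phi ->
  dominated (B * (4 * S)) (fun xi => g xi * phi xi).
Proof.
move=> [B0 mg gB] [mphi phiS]; split; first exact: cmeasurableM.
move=> xi; rewrite normcM; apply: le_weight.
set a := normc (phi xi); set x := `|xi|.
have a0 : 0 <= a := normc_ge0 _; have x0 : 0 <= x := normr_ge0 _.
have mx : Num.max 1 x ^+ d <= 1 + x ^+ d.
  rewrite maxEle; case: ifP => _; first by rewrite lerDr.
  by rewrite expr1n lerDl exprn_ge0.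
have k0 := phiS 0%N xi isT; have k2 := phiS 2%N xi isT.
have kd := phiS d xi (leqW (leqnSn d)); have kd2 := phiS d.+2 xi (leqnn _).
rewrite -/a -/x expr0 mul1r in k0 k2 kd kd2.
have -> : xi ^+ 2 = x ^+ 2 by rewrite real_normK ?num_real.
rewrite -[X in X + _]mul1r -mulrDl mulrCA.
apply: le_trans (_ : B * (1 + x ^+ d) * ((1 + x ^+ 2) * a) <= _).
  rewrite ler_wpM2r //; first by rewrite mulr_ge0 // addr_ge0 // exprn_ge0.
  by apply: le_trans (gB xi) _; rewrite ler_wpM2l.
rewrite -mulrA; apply: ler_wpM2l => //.
have -> : (1 + x ^+ d) * ((1 + x ^+ 2) * a) =
    a + x ^+ 2 * a + x ^+ d * a + x ^+ d.+2 * a by rewrite !exprS; ring.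
by rewrite (_ : 4 * S = S + S + S + S); [rewrite !lerD|ring].
Qed.

Lemma decay_schwartz f d N : schwartz f -> (d.+2 <= N)%N ->
  decay (\sum_(k < N.+1) \sum_(n < N.+1) seminorm k n f) d f.
Proof.
move=> sf dN; split.
  by have := ccontinuous_measurable (schwartz_continuous 0 sf); rewrite cderiven0.
move=> k xi kd; have := seminorm_ub k 0 xi sf; rewrite cderiven0 => h.
by apply: le_trans h _; apply: seminorm_le_sum => //; exact: leq_trans dN.
Qed.

Lemma fourier_schwartz_measurable f n : schwartz f -> cmeasurable (fourier (cderiven n f)).
Proof. by move=> sf; exact/ccontinuous_measurable/(fourier_continuous (schwartz_dominated n sf)). Qed.

Lemma decay_fourier f d n N : schwartz f -> (n + d.+2 <= N)%N ->
  decay (4 * W * (\sum_(k < N.+1) \sum_(n < N.+1) seminorm k n f)) d (fourier (cderiven n f)).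
Proof.
move=> sf dN; split; first exact: fourier_schwartz_measurable.
move=> k xi kd; apply: le_trans (normc_fourier_schwartz k n xi sf) _.
have nk : (n + k <= N)%N by apply: leq_trans dN; rewrite leq_add2l.
have N2 : (2 <= N)%N by apply: leq_trans dN; rewrite !addnS.
set S := \sum_(k < _) _.
have h0 : seminorm 0 (n + k) f <= S by exact: seminorm_le_sum.
have h2 : seminorm 2 (n + k) f <= S by exact: seminorm_le_sum.
have W0 : 0 <= W := weight_mass_ge0.
have -> : 4 * W * S = 2 * W * (S + S) by ring.
by apply: ler_wpM2l; [rewrite mulr_ge0|exact: lerD].
Qed.


Lemma growth_tempered B d g : poly_growth B d g -> tempered_function g.
Proof.
move=> gB; have [B0 _ _] := gB.
have ig f : schwartz f -> cintegrable (fun x => g x * f x).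
  by move=> sf; exact: dominated_cintegrable (pairing_dominated gB (decay_schwartz sf (leqnn _))).
split=> //; split.
  move=> c f h sf sh; have i1 := ig f sf; have i2 := ig h sh.
  rewrite /regular_distribution -cintegralZ // -cintegralD //; last exact: cintegrableZ.
  by congr cintegral; apply/funext => x; rewrite mulrDr mulrCA.
exists (2 * W * (B * 4)), d.+2 => f sf.
have [mf fB] := pairing_dominated gB (decay_schwartz sf (leqnn _)).
by apply: le_trans (normc_cintegral_le mf fB) _; rewrite !mulrA.
Qed.

Definition spectral_derivative (p : nat) g : tdistribution :=
  dderiven p (dinverse_fourier (regular_distribution g)).

Let kappa : C := (Num.sqrt (2 * pi : R))^-1%:C.

Lemma spectral_derivativeE p B d g f : poly_growth B d g -> schwartz f ->
  spectral_derivative p g f =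
  (-1) ^+ p * (kappa * cintegral (fun xi => g xi * fourier (cderiven p f) xi)).
Proof.
move=> gB sf; rewrite /spectral_derivative /dderiven /dinverse_fourier; congr (_ * _).
rewrite -cintegralZ.
  by congr cintegral; apply/funext => xi; rewrite [RHS]mulrCA.
exact: dominated_cintegrable (pairing_dominated gB (decay_fourier sf (leqnn _))).
Qed.

Lemma fourier_linear c f h xi n : schwartz f -> schwartz h ->
  fourier (cderiven n (fun x => c * f x + h x)) xi =
  c * fourier (cderiven n f) xi + fourier (cderiven n h) xi.
Proof.
move=> sf sh.
have i1 := dominated_cintegrable (dominated_modulate xi (schwartz_dominated n sf)).
have i2 := dominated_cintegrable (dominated_modulate xi (schwartz_dominated n sh)).
rewrite cderiven_linear // /fourier -cintegralZ // -cintegralD //; last exact: cintegrableZ.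
by congr cintegral; apply/funext => x; rewrite mulrDl mulrA.
Qed.

Lemma spectral_derivative_tempered p B d g : poly_growth B d g ->
  tempered (spectral_derivative p g).
Proof.
move=> gB; have [B0 _ _] := gB.
have dom f (sf : schwartz f) := pairing_dominated gB (decay_fourier sf (leqnn (p + d.+2))).
split.
  move=> c f h sf sh.
  have i1 := dominated_cintegrable (dom f sf); have i2 := dominated_cintegrable (dom h sh).
  rewrite (spectral_derivativeE _ gB sf) (spectral_derivativeE _ gB sh).
  rewrite /spectral_derivative /dderiven /dinverse_fourier /regular_distribution.
  rewrite [X in cintegral X](_ : _ = (fun xi => kappa * (c * (g xi * fourier (cderiven p f) xi) + g xi * fourier (cderiven p h) xi))); last first.
    apply/funext => xi; rewrite /inverse_fourier -/(fourier _ xi) fourier_linear // -/kappa; ring.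
  rewrite cintegralZ; last by apply: cintegrableD => //; exact: cintegrableZ.
  rewrite cintegralD //; last exact: cintegrableZ.
  rewrite cintegralZ //; move: (cintegral _) (cintegral _) kappa ((-1) ^+ p) => X Y k z; ring.
exists (normc kappa * (2 * W * (B * (4 * (4 * W))))), (p + d.+2)%N => f sf.
rewrite (spectral_derivativeE _ gB sf) normcM normcX normcN normc1 expr1n mul1r normcM.
rewrite -[leRHS]mulrA; apply: ler_wpM2l; first exact: normc_ge0.
have [mf fB] := dom f sf.
by apply: le_trans (normc_cintegral_le mf fB) _; rewrite !mulrA.
Qed.

(** A test function supported away from [-N, N] is annihilated by the inverse
transform of each trigonometric polynomial u n, and hence by the limit. *)
Lemma spectral_derivative_support p B d g (u : nat -> R -> C) (N : R) :
  (forall n, trigpoly N (u n)) ->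
  (forall n xi, normc (u n xi) <= B * Num.max 1 `|xi| ^+ d) -> 0 <= B ->
  (forall xi, ccvg (u^~ xi) (g xi)) ->
  forall B', poly_growth B' d g ->
  compact (dsupport (spectral_derivative p g)).
Proof.
move=> uN uB B0 ug B' gB'.
have cl : closed (dsupport (spectral_derivative p g)).
  move=> x clx U oU Ux.
  have [y [sy Uy]] : dsupport (spectral_derivative p g) `&` U !=set0.
    by apply: clx; exact: open_nbhs_nbhs.
  exact: sy.
apply: (subclosed_compact cl (@segment_compact _ (- N) N)) => x sx.
rewrite /= in_itv /= -ler_norml; rewrite leNgt; apply/negP => Nx.
have oU : open [set y : R | N < `|y|].
  have -> : [set y : R | N < `|y|] = (fun y : R => `|y|) @^-1` [set z | N < z] by [].
  apply: open_comp; last exact: open_gt.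
  by move=> y _; apply: cvg_norm; exact: cvg_id.
have [f [sf cf fU /eqP]] := sx _ oU Nx; apply.
rewrite (spectral_derivativeE _ gB' sf).
suff -> : cintegral (fun xi => g xi * fourier (cderiven p f) xi) = 0 by rewrite !mulr0.
have [S D] : exists S, decay S d (fourier (cderiven p f)).
  by eexists; exact: decay_fourier sf (leqnn (p + d.+2)).
have cu n : poly_growth B d (u n).
  by split => //; exact/ccontinuous_measurable/(trigpoly_continuous (uN n)).
have zero n : cintegral (fun xi => u n xi * fourier (cderiven p f) xi) = 0.
  have domF : exists B1, dominated B1 (fourier (cderiven p f)).
    exists (S + S); split; first exact: fourier_schwartz_measurable.
    move=> xi; apply: le_weight; rewrite -[xi ^+ 2]real_normK ?num_real //.
    have [_ Dk] := D; apply: lerD; last exact: Dk 2%N xi isT.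
    by have := Dk 0%N xi isT; rewrite expr0 mul1r.
  have [B1 DF] := domF.
  apply: (trigpoly_pairing_eq0 (uN n) DF) => x0 x0N.
  have nfx : ~ fsupport f x0 by move=> /fU /=; rewrite ltNge x0N.
  have : open (~` fsupport f) by apply: closed_openC; exact: closed_closure.
  rewrite openE => /(_ x0 nfx) /nbhs_ballP[delta /= delta0 bd].
  apply: (@cintegral_fourier_vanish _ x0 delta) => // k _.
  apply: cderiven_vanish => x' x'd; apply/eqP/negPn/negP => fx'.
  by apply: (bd x'); [rewrite /ball /= distrC|apply: subset_closure].
have H : ccvg (fun n => cintegral (fun xi => u n xi * fourier (cderiven p f) xi))
   (cintegral (fun xi => g xi * fourier (cderiven p f) xi)).
  apply: (@cintegral_cvg _ _ _ (B * (4 * S))).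
  - by move=> n; have [] := pairing_dominated (cu n) D.
  - by move=> xi; apply: ccvgM; [exact: ug|exact: ccvg_cst].
  - by move=> n; have [] := pairing_dominated (cu n) D.
apply: (ccvg_unique H); rewrite (_ : (fun n => _) = fun=> 0); first exact: ccvg_cst.
exact/funext.
Qed.

(** The substitution y = 2 x - c. *)
Lemma fourier_affine f (c xi : R) B : dominated B f -> ccontinuous f ->
  fourier (fun y => f ((y + c) / 2)) xi = 2 * (expi (- c * xi) * fourier f (2 * xi)).
Proof.
move=> domf cf.
have im := dominated_cintegrable (dominated_modulate (2 * xi) domf).
have h1 : (fun x : R => f ((2 * x + - c + c) / 2) * expi (xi * (2 * x + - c))) =
    (fun x => expi (- c * xi) * (f x * expi (2 * xi * x))).
  apply/funext => x; rewrite (_ : (2 * x + - c + c) / 2 = x); last by field.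
  rewrite [RHS]mulrCA -expiD; congr (_ * expi _); ring.
have i0 : cintegrable (fun x => f ((x + c) / 2) * expi (xi * x)).
  apply/(@cintegrable_affine _ 2 (- c)) => //; last by rewrite h1; exact: cintegrableZ.
  apply: cmeasurableM; last exact/ccontinuous_measurable/ccontinuous_expi.
  have := cmeasurable_affine 2^-1 (c / 2) (ccontinuous_measurable cf).
  by congr cmeasurable; apply/funext => x; congr f; rewrite mulrDl mulrC.
rewrite /fourier (@cintegral_affine _ 2 (- c) _ _ i0) // h1 cintegralZ //.
by rewrite rmorph_nat.
Qed.

Lemma inverse_fourier_affine p f (c xi : R) : schwartz f ->
  inverse_fourier (cderiven p (fun y => f ((y + c) / 2))) xi =
  kappa * (2 ^- p * (2 * (expi (- c * xi) * fourier (cderiven p f) (2 * xi)))).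
Proof.
move=> sf; have domf := schwartz_dominated p sf.
have cf := schwartz_continuous p sf.
rewrite cderiven_affine // /inverse_fourier -/kappa; congr (_ * _).
rewrite -[LHS]/(fourier (fun y => 2 ^- p * cderiven p f ((y + c) / 2)) xi).
rewrite (@fourier_affine (fun y => 2 ^- p * cderiven p f y) c xi _ (dominatedZ (2 ^- p) domf)); last first.
  by apply: ccontinuousM => //; exact: ccontinuous_cst.
have -> : fourier (fun y => 2 ^- p * cderiven p f y) (2 * xi) = 2 ^- p * fourier (cderiven p f) (2 * xi).
  rewrite /fourier -cintegralZ; last exact: dominated_cintegrable (dominated_modulate (2 * xi) domf).
  by congr cintegral; apply/funext => x; rewrite mulrA.
by rewrite [RHS]mulrCA; congr (_ * _); rewrite mulrCA.
Qed.

Lemma decay_dilate S d phi (a : R) : decay S d phi ->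
  decay S d (fun xi => expi (a * xi) * phi (2 * xi)).
Proof.
move=> [mphi phiS]; split.
  apply: cmeasurableM; first exact/ccontinuous_measurable/ccontinuous_expi.
  by have := cmeasurable_affine 2 0 mphi; congr cmeasurable; apply/funext => x; rewrite addr0.
move=> k xi kd; rewrite normcM normc_expi mul1r.
apply: le_trans (phiS k (2 * xi) kd); apply: ler_wpM2r; first exact: normc_ge0.
by apply: lerXn2r; rewrite ?nnegrE ?normr_ge0 // normrM normr_nat ler_peMl // ler1n.
Qed.
End Pairing.

(** * The dual refinement equation *)

Section DualProduct.
Context {R : realType}.
Local Notation C := R[i].
Variables (p : nat) (At : int -> 'M[C]_p.+1).

Definition dual_factor (t : R) : 'M[C]_p.+1 :=
  2 ^- p *: mx_symbol At (expi (- t)).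

Variables (s : seq int) (s_uniq : uniq s) (At_supp : forall k, k \notin s -> At k = 0).

Let coef k i j : C := 2 ^- p * (2^-1 * At k i j).

Lemma dual_factorE t i j :
  dual_factor t i j = \sum_(k <- s) coef k i j * expi (- k%:~R * t).
Proof.
rewrite /dual_factor /mx_symbol (@fsumT_seq _ s) //; last first.
  by move=> k /At_supp ->; rewrite scaler0.
rewrite !mxE summxE !mulr_sumr; apply: eq_bigr => k _.
by rewrite mxE expi_exprz mulrN mulNr /coef; move: (expi _) (At k i j) (2 ^- p) (2^-1) => x y z u; ring.
Qed.

Let freq : R := \sum_(k <- s) `|k%:~R|.

Let freq_ge0 : 0 <= freq. Proof. exact: sumr_ge0. Qed.

Lemma dual_factor_trigpoly i j : trigpoly freq (fun t => dual_factor t i j).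
Proof.
exists [seq (coef k i j, k%:~R) | k <- s].
  apply/allP => _ /mapP[k ks ->] /=; rewrite /freq (big_rem k) //= lerDl.
  exact: sumr_ge0.
by move=> t; rewrite dual_factorE big_map.
Qed.

(** Each peeling halves the frequencies of the remaining product, and the first
factor contributes at most freq / 2: the bound freq = freq / 2 + freq / 2 is
stable, uniformly in n. *)
Lemma partial_product_trigpoly n i j :
  trigpoly freq (fun xi => partial_product dual_factor n xi i j).
Proof.
elim: n i j => [|n IH] i j.
  under eq_fun do rewrite partial_product0; exact: trigpoly_cst.
under eq_fun do rewrite partial_productSl mxE.
apply: trigpoly_sum => // k.
have -> : freq = freq / 2 + freq / 2 by field.
apply: trigpolyM; [exact: trigpoly_half (dual_factor_trigpoly i k)|exact: trigpoly_half (IH k j)].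
Qed.

Let size : R := \sum_i \sum_j \sum_(k <- s) normc (coef k i j) * (1 + 2 * `|k%:~R|).

Let size_ge0 : 0 <= size.
Proof.
apply: sumr_ge0 => i _; apply: sumr_ge0 => j _; apply: sumr_ge0 => k _.
by rewrite mulr_ge0 ?normc_ge0 // addr_ge0 // mulr_ge0.
Qed.

Let le_size i j : \sum_(k <- s) normc (coef k i j) * (1 + 2 * `|k%:~R|) <= size.
Proof.
have pos a b : 0 <= \sum_(k <- s) normc (coef k a b) * (1 + 2 * `|k%:~R : R|).
  by apply: sumr_ge0 => k _; rewrite mulr_ge0 ?normc_ge0 // addr_ge0 // mulr_ge0.
rewrite /size (bigD1 i) //= (bigD1 j) //= -addrA lerDl addr_ge0 //.
  by apply: sumr_ge0 => b _; exact: pos.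
by apply: sumr_ge0 => a _; apply: sumr_ge0 => b _; exact: pos.
Qed.

Lemma dual_factor_le t i j : normc (dual_factor t i j) <= size * 1.
Proof.
rewrite mulr1; apply: le_trans (le_size i j); rewrite dual_factorE.
apply: le_trans (ler_normc_sum _ _ _) _; apply: ler_sum => k _.
by rewrite normcM normc_expi ler_wpM2l ?normc_ge0 // lerDl mulr_ge0.
Qed.

Lemma dual_factor_lipschitz t i j :
  normc ((dual_factor t - dual_factor 0) i j) <= size * `|t|.
Proof.
have -> : (dual_factor t - dual_factor 0) i j =
    \sum_(k <- s) coef k i j * (expi (- k%:~R * t) - 1).
  rewrite mxE [X in _ + X]mxE.
  rewrite (congr2 (fun x y : C => x - y) (dual_factorE t i j) (dual_factorE 0 i j)).
  by rewrite -sumrB; apply: eq_bigr => k _; rewrite mulr0 expi0 -mulrBr.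
apply: le_trans (ler_normc_sum _ _ _) _.
apply: le_trans (ler_wpM2r (normr_ge0 t) (le_size i j)); rewrite mulr_suml.
apply: ler_sum => k _; rewrite normcM -mulrA ler_wpM2l ?normc_ge0 //.
apply: le_trans (normc_expi_sub1 _) _.
by rewrite normrM normrN mulrA ler_wpM2r // lerDr.
Qed.

Lemma normc_nat (n : nat) : normc (n%:R : C) = n%:R.
Proof.
have -> : (n%:R : C) = (n%:R : R)%:C by rewrite rmorph_nat.
by rewrite normc_real normr_nat.
Qed.

Hypothesis At_triangular : forall i j : 'I_p.+1, (j < i)%N -> mx_symbol At 1 i j = 0.
Hypothesis At_diagonal : forall i : 'I_p.+1, mx_symbol At 1 i i = 2 ^+ i.

Lemma dual_factor0 : dual_factor 0 = 2 ^- p *: mx_symbol At 1.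
Proof. by rewrite /dual_factor oppr0 expi0. Qed.

(** The entries of the factor are trigonometric polynomials, hence bounded and
Lipschitz, and [triangular_weight] applies to its value at 0. *)
Lemma dual_product_bounds : exists (w : 'I_p.+1 -> R) (L : R) (d : nat),
  [/\ forall i, 0 < w i, 0 <= L, wnorm_le w 1 (dual_factor 0),
      forall t, wnorm_le w (L * `|t|) (dual_factor t - dual_factor 0) &
      forall t, wnorm_le w (2 ^+ d) (dual_factor t)].
Proof.
have diag (i : 'I_p.+1) : normc (dual_factor 0 i i) = 2 ^+ i / 2 ^+ p.
  rewrite dual_factor0 mxE At_diagonal normcM normcV !normcX normc_nat.
  by rewrite mulrC.
have [||| w w0 w1] := @triangular_weight R p (dual_factor 0).
- by move=> i j ji; rewrite dual_factor0 mxE At_triangular // mulr0.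
- move=> i ip; rewrite diag ler_pdivrMr ?exprn_gt0 // ler_pdivlMl // -exprS.
  by rewrite ler_eXn2l // ltr1n.
- by rewrite diag /= divff // expf_neq0 // pnatr_eq0.
have [K K0 HK] := wnorm_le_entries w0 size_ge0.
(* K < truncn K + 1 <= 2^(truncn K + 1) *)
exists w, K, (Num.truncn K).+1; split; [exact: w0|exact: K0|exact: w1| |].
  by move=> t; apply: HK => [|i j]; [exact: normr_ge0|exact: dual_factor_lipschitz].
move=> t; apply: (wnorm_leW w0 _ (HK (dual_factor t) 1 ler01 (dual_factor_le t))).
rewrite mulr1 (le_trans (ltW (truncnS_gt K))) // -natrX ler_nat ltnW //.
exact: ltn_expl.
Qed.

Variables (d : nat) (B : R) (g : R -> 'cV[C]_p.+1).
Hypothesis g_growth : forall i, poly_growth B d (fun xi => g xi i 0).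
Hypothesis g_refine : forall xi : R, g xi = dual_factor (xi / 2) *m g (xi / 2).

(** After the substitution y = 2 x - k on the test function, the right-hand side is
the pairing of M(xi) g(xi), that is g(2 xi), with the transform at 2 xi. *)
Lemma spectral_derivative_refinable :
  matrix_refinable At (fun q => spectral_derivative p (fun xi => g xi q 0)).
Proof.
move=> q f sf.
set kappa : C := (Num.sqrt (2 * pi : R))^-1%:C.
set F := fourier (cderiven p f).
have [S FS] : exists S, decay S d F.
  by eexists; exact: decay_fourier sf (leqnn (p + d.+2)).
pose I (k : int) (l : 'I_p.+1) := cintegral (fun xi => g xi l 0 * (expi (- k%:~R * xi) * F (2 * xi))).
have iI (k : int) l : cintegrable (fun xi => g xi l 0 * (expi (- k%:~R * xi) * F (2 * xi))).
  exact: dominated_cintegrable (pairing_dominated (g_growth l) (decay_dilate (- k%:~R) FS)).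
have shiftE k l : refine_shift k (spectral_derivative p (fun xi => g xi l 0)) f =
    2^-1 * ((-1) ^+ p * (kappa * (2 ^- p * (2 * I k l)))).
  rewrite /refine_shift /spectral_derivative /dderiven /dinverse_fourier /regular_distribution.
  congr (_ * (_ * _)).
  rewrite /I -cintegralZ // -cintegralZ; last exact: cintegrableZ.
  rewrite -cintegralZ; last by do 2 apply: cintegrableZ.
  congr cintegral; apply/funext => xi; rewrite inverse_fourier_affine //.
  rewrite -/F -/kappa; move: kappa (g xi l 0) (2 ^- p) (F _) (expi _) => a b c e h; ring.
have iq := dominated_cintegrable (pairing_dominated (g_growth q) FS).
rewrite (spectral_derivativeE p (g_growth q) sf) -/kappa -/F.
rewrite (@cintegral_affine _ 2 0 _ _ iq) //.
have -> : (fun x : R => g (2 * x + 0) q 0 * F (2 * x + 0)) =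
    (fun x => \sum_l \sum_(k <- s) coef k q l * (g x l 0 * (expi (- k%:~R * x) * F (2 * x)))).
  apply/funext => x; rewrite addr0 g_refine [2 * x]mulrC mulfK ?pnatr_eq0 // mxE mulr_suml.
  apply: eq_bigr => l _; rewrite dual_factorE !mulr_suml; apply: eq_bigr => k _.
  move: (coef k q l) (expi _) (g x l 0) (F _) => a b c e; ring.
rewrite cintegral_sum; last by move=> l; apply: cintegrable_sum => k; exact: cintegrableZ.
rewrite (@fsumT_seq _ s) //; last first.
  by move=> k /At_supp ->; rewrite big1 // => l _; rewrite mxE mul0r.
rewrite exchange_big /= rmorph_nat !mulr_sumr; apply: eq_bigr => l _.
rewrite cintegral_sum; last by move=> k; exact: cintegrableZ.
rewrite !mulr_sumr; apply: eq_bigr => k _.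
rewrite shiftE cintegralZ // -/(I k l) /coef; clear shiftE.
move: kappa (I k l) (2 ^- p) (2^-1) ((-1) ^+ p) (At k q l) => a b c e h x; ring.
Qed.
End DualProduct.

Theorem lemma5p6 (R : realType) (m mt p : nat)
    (m_gt0 : (0 < m)%N) (mt_gt0 : (0 < mt)%N) (le_m_mt : (m <= mt)%N)
    (even_m_mt : ~~ odd (m + mt))
    (b : int -> R) (hb : cdf_wavelet_coef m mt b)
    (At : int -> 'M[R[i]]_p.+1) (hAt : dual_refinement_matrices m b At)
    (v : 'cV[R[i]]_p.+1) (v_neq0 : v != 0)
    (v_eigen : (2 ^- p *: mx_symbol At 1) *m v = v) :
  exists g : R -> 'cV[R[i]]_p.+1,
    [/\ (forall (xi : R) (q : 'I_p.+1),
           ccvg (fun n => dual_partial_product At v n xi q 0) (g xi q 0)),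
        (forall q : 'I_p.+1, tempered_function (fun xi => g xi q 0)) &
        let Phi := fun q : 'I_p.+1 =>
          dderiven p (dinverse_fourier
                        (regular_distribution (fun xi => g xi q 0))) in
        (forall q, tempered (Phi q) /\ compact (dsupport (Phi q))) /\
        matrix_refinable At Phi].
Proof.
have [tri diag] := dual_symbol_at1 m_gt0 mt_gt0 hb hAt.
have [/finite_seqP[r Er] _] := hAt.
pose s := undup r.
have At0 k : k \notin s -> At k = 0.
  rewrite mem_undup => kr; apply/eqP/negPn/negP => Ak; case/negP: kr.
  by have : [set` r] k by rewrite -Er.
have us : uniq s := undup_uniq r.
have [w [L [d [w0 L0 M0 ML MK]]]] := dual_product_bounds us At0 tri diag.
have M0v : dual_factor At 0 *m v = v by rewrite dual_factor0.
have cvP xi i := partial_product_cvg w0 L0 M0 ML M0v xi i.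
have [B B0 growth] := partial_product_growth v w0 L0 M0 ML MK.
pose u i n xi := (partial_product (dual_factor At) n xi *m v) i 0.
have [G HG] := @choice _ _ (fun (x : R * 'I_p.+1) l => ccvg (fun n => u x.2 n x.1) l)
  (fun x => cvP x.1 x.2).
pose g xi : 'cV[R[i]]_p.+1 := \col_i G (xi, i).
have ug i xi : ccvg (fun n => u i n xi) (g xi i 0) by rewrite mxE; exact: (HG (xi, i)).
have ut i n : trigpoly (\sum_(k <- s) `|k%:~R|) (u i n).
  rewrite (_ : u i n = fun xi => \sum_j partial_product (dual_factor At) n xi i j * v j 0); last first.
    by apply/funext => xi; rewrite /u mxE.
  apply: trigpoly_sum => [|j]; first exact: sumr_ge0.
  rewrite -[X in trigpoly X]addr0; apply: trigpolyM; last exact: trigpoly_cst.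
  exact: partial_product_trigpoly.
have gB i : poly_growth (B *+ 2) d (fun xi => g xi i 0).
  split; first by rewrite mulrn_wge0.
    apply: (@ccvg_cmeasurable _ (u i)) => n; last exact: ug.
    exact/ccontinuous_measurable/(trigpoly_continuous (ut i n)).
  move=> xi; rewrite mulrnAl; apply: ccvg_le (ug i xi) _ => n; exact: growth.
have gref xi : g xi = dual_factor At (xi / 2) *m g (xi / 2).
  exact: infinite_product_refine (fun xi i => ug i xi) xi.
exists g; split; first by move=> xi q; exact: ug.
  by move=> q; exact: growth_tempered (gB q).
split; last exact (spectral_derivative_refinable us At0 gB gref).
move=> q; split; first exact: spectral_derivative_tempered (gB q).
exact: (spectral_derivative_support (ut q) (fun n xi => growth n xi q) B0 (ug q) (gB q)).
Qed.
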